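(* Let $r,\delta,n$ be positive integers with $\delta>r$ and $n\ge 2\delta+2$, and let $G$ be a simple graph of order $n$ with edge connectivity $r$ and minimum degree $\delta$. Then \[\tau(G)\le r(\delta+1)^{\delta-r}(n-\delta-1)^{n-\delta-r-2}\big[(\delta+1)(n-\delta-1)+n\big]^{r-1},\] with equality if and only if $G\cong M^r_{n-\delta-1,\delta+1}$.
   Context: All graphs are finite and simple. $\tau(G)$ denotes the number of spanning trees of $G$. The edge connectivity of a connected graph $G$ is the minimum size of a set $U\subseteq E(G)$ such that $G-U$ is disconnected. For positive integers $n_1\ge n_2\ge q$, $M^q_{n_1,n_2}$ denotes the graph obtained from the disjoint union of complete graphs $K_{n_1}$ and $K_{n_2}$ by adding $q$ pairwise disjoint edges, each joining a vertex of $K_{n_1}$ to a vertex of $K_{n_2}$. *)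

(* Defs.v *)
From mathcomp Require Import all_boot.

Set Implicit Arguments.
Unset Strict Implicit.
Unset Printing Implicit Defensive.

Record sgraph (V : finType) := SGraph {
  adj :> rel V;
  adj_sym : symmetric adj;
  adj_irr : irreflexive adj
}.

(* An edge is the two-element set of its endpoints. *)
Definition edges (V : finType) (G : sgraph V) : {set {set V}} :=
  [set [set p.1; p.2] | p : V * V & G p.1 p.2].

Fact sub_adj_sym (V : finType) (G : sgraph V) (F : {set {set V}}) :
  symmetric (fun x y => G x y && ([set x; y] \in F)).
Proof. by move=> x y; rewrite adj_sym setUC. Qed.

Fact sub_adj_irr (V : finType) (G : sgraph V) (F : {set {set V}}) :
  irreflexive (fun x y => G x y && ([set x; y] \in F)).
Proof. by move=> x; rewrite adj_irr. Qed.

Definition spanning_subgraph (V : finType) (G : sgraph V) (F : {set {set V}}) :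
  sgraph V := SGraph (sub_adj_sym G F) (sub_adj_irr G F).

Definition del_edges (V : finType) (G : sgraph V) (U : {set {set V}}) :
  sgraph V := spanning_subgraph G (edges G :\: U).

Definition connected (V : finType) (G : sgraph V) : bool :=
  [forall x, forall y, connect G x y].

(* A cycle of G visits at least 3 vertices, all distinct; its length is at most
   #|V|, which makes acyclicity decidable, see acyclicP. *)
Definition acyclic (V : finType) (G : sgraph V) : bool :=
  [forall k : 'I_#|V|.+1, forall c : k.-tuple V, (2 < k) ==> ~~ ucycleb G c].

Lemma acyclicP (V : finType) (G : sgraph V) :
  reflect (forall c : seq V, 2 < size c -> ~ ucycle G c) (acyclic G).
Proof.
apply: (iffP forallP) => [acG c c_gt2 cycG | acG k]; last first.
  apply/forallP => c; apply/implyP => k_gt2; apply/negP => cycG.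
  by apply: (acG c) => //; rewrite size_tuple.
have ltcV : size c < #|V|.+1.
  by case/andP: cycG => _ /card_uniqP <-; rewrite ltnS max_card.
have /forallP/(_ (in_tuple c))/implyP/(_ c_gt2) := acG (Ordinal ltcV).
by rewrite [ucycleb _ _]cycG.
Qed.

Definition is_tree (V : finType) (G : sgraph V) : bool :=
  connected G && acyclic G.

(* tau(G), the number of spanning trees; a spanning tree is identified with its
   edge set. *)
Definition tau (V : finType) (G : sgraph V) : nat :=
  #|[set F : {set {set V}} | (F \subset edges G)
                             && is_tree (spanning_subgraph G F)]|.

Definition degree (V : finType) (G : sgraph V) (x : V) : nat :=
  #|[set y | G x y]|.

(* Every degree is less than #|V|, so the initial value #|V| matters only when V
   is empty. *)
Definition min_degree (V : finType) (G : sgraph V) : nat :=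
  \big[minn/#|V|]_(x : V) degree G x.

(* If G has at least two vertices, removing all its edges disconnects it, so the
   starting point edges G of the minimisation satisfies the constraint. *)
Definition edge_connectivity (V : finType) (G : sgraph V) : nat :=
  #|[arg min_(U < edges G | (U \subset edges G) && ~~ connected (del_edges G U))
       #|U|]|.

Lemma edge_connectivityP (V : finType) (G : sgraph V) (r : nat) :
  1 < #|V| ->
  edge_connectivity G = r <->
  (exists U : {set {set V}},
      [/\ U \subset edges G, ~~ connected (del_edges G U) & #|U| = r]) /\
  (forall U : {set {set V}},
      U \subset edges G -> ~~ connected (del_edges G U) -> r <= #|U|).
Proof.
move=> V_gt1; rewrite /edge_connectivity.
have PE : (edges G \subset edges G) && ~~ connected (del_edges G (edges G)).
  rewrite subxx /=; apply/negP => /forallP conn.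
  have /card_gt1P[x [y [_ _ /eqP neq_xy]]] := V_gt1.
  have /forallP/(_ y)/connectP[[|z p] /=] := conn x.
    by move=> _ eq_yx; case: neq_xy.
  by rewrite setDv inE andbF.
case: arg_minnP => // U /andP[sUE dU] minU; split=> [<- | [[W [sW dW <-]] min]].
  split=> [|W sW dW]; first by exists U.
  by apply: minU; rewrite sW.
by apply/eqP; rewrite eqn_leq min // minU // sW.
Qed.

Lemma min_degreeP (V : finType) (G : sgraph V) (d : nat) :
  0 < #|V| ->
  min_degree G = d <->
  (exists x, degree G x = d) /\ (forall x, d <= degree G x).
Proof.
have deg_lt x : degree G x < #|V|.
  rewrite -cardsT; apply: proper_card; apply/properP; split; first exact: subsetT.
  by exists x; rewrite inE ?adj_irr.
have le_min x : min_degree G <= degree G x.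
  rewrite /min_degree; have := mem_index_enum x.
  elim: (index_enum V) => // y s IHs; rewrite inE big_cons geq_min.
  by case/orP=> [/eqP-> | /IHs->]; rewrite ?leqnn ?orbT.
have ex_min : 0 < #|V| -> exists x, degree G x = min_degree G.
  move=> /card_gt0P[x0 _].
  have [//|eqV] : (exists x, degree G x = min_degree G) \/ min_degree G = #|V|.
    rewrite /min_degree; elim/big_ind: _ => [|a b Ha Hb|x _]; first by right.
      by case: (leqP a b).
    by left; exists x.
  by have := leq_ltn_trans (le_min x0) (deg_lt x0); rewrite eqV ltnn.
move=> V0; split=> [<- | [[x <-] min]]; first by split; [apply: ex_min|].
have [y Hy] := ex_min V0.
by apply/eqP; rewrite eqn_leq le_min -Hy min.
Qed.

Definition isomorphic (V W : finType) (G : sgraph V) (H : sgraph W) : Prop :=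
  exists2 f : V -> W, bijective f & forall x y, H (f x) (f y) = G x y.

(* For q <= n2 <= n1, the i-th added edge, i < q, joins the i-th vertices of the
   two complete graphs; any other choice of q pairwise disjoint edges gives an
   isomorphic graph. *)
Definition Madj (q n1 n2 : nat) : rel ('I_n1 + 'I_n2) := fun u v =>
  match u, v with
  | inl i, inl j => i != j
  | inr i, inr j => i != j
  | inl i, inr j | inr j, inl i => (i == j :> nat) && (i < q)
  end.

Fact Madj_sym (q n1 n2 : nat) : symmetric (@Madj q n1 n2).
Proof. by case=> i [] j //=; rewrite eq_sym. Qed.

Fact Madj_irr (q n1 n2 : nat) : irreflexive (@Madj q n1 n2).
Proof. by case=> i /=; rewrite eqxx. Qed.

Definition Mgraph (q n1 n2 : nat) : sgraph ('I_n1 + 'I_n2)%type :=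
  SGraph (@Madj_sym q n1 n2) (@Madj_irr q n1 n2).

(* Main.v *)
Require Import Defs.
From mathcomp Require Import all_boot.
From mathcomp Require Import all_order all_algebra all_fingroup ring zify.

(* A minimum edge cut splits V into sides of sizes a, b; since r < delta both exceed
   delta. Completing both sides to cliques, a multilinear expansion of the reduced
   Laplacian (matrix-tree theorem) and Sylvester's determinant identity give
   tau = a^(a-2) b^(b-2) 1^T adj(I + K) 1, where K is the r x r Gram matrix of the
   cut edges: K_ee = 1/a + 1/b, and K_ef >= 0 is positive exactly when e and f meet.
   Removing the mean of the Gram vectors, Hadamard's inequality and AM-GM bound this
   by r (1 + 1/a + 1/b)^(r-1) times the prefactor, with equality iff the cut edges
   are pairwise disjoint. The resulting function of (a, b) is strictly largest at
   b = delta + 1, and adding an edge to a connected graph strictly increases tau. *)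

Set Implicit Arguments.
Unset Strict Implicit.
Unset Printing Implicit Defensive.
Import Order.TTheory GRing.Theory Num.Theory.

(** Parent functions serve twice: a determinant expanded by rows is a sum over functions, which
    leads to the matrix-tree theorem without minors, and a new edge enters a tree by redirecting one
    parent. The Laplacian is perturbed by a rank-one matrix instead of losing a row and a column.
    The perturbation is free up to a known scalar, and a suitable choice leaves a determinant of
    order r + 1. The obstacle is then that 1^T adj(I + K) 1 is not itself the determinant of a
    positive definite matrix. It depends only on I + K compressed to the vectors of sum zero, so the
    all-ones direction can be given a new eigenvalue; with 1 + 1/a + 1/b, disjoint cross edges yield
    a scalar matrix, for which Hadamard and AM-GM are both sharp. Neither inequality needs
    eigenvalues, so the rationals suffice as scalars. *)

(** * Spanning trees as parent functions *)

(* Parent functions of the spanning trees of G rooted at rho; the root is its own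
   parent. *)
Definition rooted (V : finType) (G : sgraph V) (rho : V) : {set {ffun V -> V}} :=
  [set f : {ffun V -> V} | [&& f rho == rho,
     [forall v, (v != rho) ==> G v (f v)] & [forall v, fconnect f v rho]]].

(** The rank is the least number of iterations that lead to [rho]. A rank decreasing towards the
    root is the form in which acyclicity is used in the inductions below. *)
Lemma fconnect_rank (V : finType) (f : V -> V) (rho : V) :
  (forall v, fconnect f v rho) ->
  exists d : V -> nat, forall v, v != rho -> d (f v) < d v.
Proof.
move=> fc.
have ex v : exists k, iter k f v == rho.
  by have /iter_findex <- := fc v; exists (findex f v rho).
exists (fun v => ex_minn (ex v)) => v vNrho.
case: ex_minnP => m _ minm; case: ex_minnP => -[|k] /eqP itk _.
  by rewrite /= in itk; rewrite itk eqxx in vNrho.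
by rewrite ltnS minm // -iterSr itk.
Qed.

Lemma rank_fconnect (V : finType) (f : V -> V) (rho : V) (d : V -> nat) :
  (forall v, v != rho -> d (f v) < d v) -> forall v, fconnect f v rho.
Proof.
move=> dP v; have [n] := ubnP (d v); elim: n v => // n IHn v ltvn.
have [->|vNrho] := eqVneq v rho; first exact: connect0.
apply: connect_trans (fconnect1 f v) (IHn _ _).
by apply: leq_trans (dP _ vNrho) _; rewrite -ltnS.
Qed.

Lemma rootedP (V : finType) (G : sgraph V) (rho : V) (f : {ffun V -> V}) :
  f \in rooted G rho ->
  [/\ f rho = rho, forall v, v != rho -> G v (f v)
    & exists d : V -> nat, forall v, v != rho -> d (f v) < d v].
Proof.
rewrite inE => /and3P[/eqP f0 /forallP fG /forallP fc]; split=> //.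
  by move=> v; apply/implyP.
exact: fconnect_rank.
Qed.

Lemma rank_rooted (V : finType) (G : sgraph V) (rho : V) (f : {ffun V -> V})
    (d : V -> nat) :
  f rho = rho -> (forall v, v != rho -> G v (f v) /\ d (f v) < d v) ->
  f \in rooted G rho.
Proof.
move=> f0 fP; rewrite inE f0 eqxx /=; apply/andP; split; apply/forallP=> v.
  by apply/implyP=> /fP[].
by apply: (@rank_fconnect _ _ _ d) => w /fP[].
Qed.

(** Breadth-first search: [d] is the distance to [rho], and every other vertex picks a neighbour
    closer to it. Walks are tuples so that their existence is decidable and [ex_minn] applies. *)
Lemma connected_rooted (V : finType) (G : sgraph V) (rho : V) :
  connected G -> exists f, f \in rooted G rho.
Proof.
move=> /forallP conn.
pose P v k := [exists t : k.-tuple V, path G v t && (last v t == rho)].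
have ex v : exists k, P v k.
  have /forallP/(_ rho)/connectP[p pP lp] := conn v.
  by exists (size p); apply/existsP; exists (in_tuple p); rewrite /= pP lp eqxx.
pose d v := ex_minn (ex v).
have dP v : v != rho -> exists w, G v w && (d w < d v).
  move=> vNrho; rewrite {2}/d; case: ex_minnP => k /existsP[t /andP[pt /eqP lt]] _.
  case: k t pt lt => [|k] t.
    by rewrite tuple0 /= => _ vr; rewrite vr eqxx in vNrho.
  case/tupleP: t => w t /= /andP[vw pt] lt; exists w; rewrite vw /= ltnS.
  rewrite /d; case: ex_minnP => m _; apply.
  by apply/existsP; exists t; rewrite pt lt eqxx.
exists [ffun v => if v == rho then rho
                  else odflt v [pick w | G v w && (d w < d v)]].
apply: (@rank_rooted _ _ _ _ d); first by rewrite ffunE eqxx.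
move=> v vNrho; rewrite ffunE (negPf vNrho); case: pickP => /= [w /andP[]//|no].
by have [w] := dP v vNrho; rewrite no.
Qed.

Definition parent_edges (V : finType) (rho : V) (f : {ffun V -> V}) : {set {set V}} :=
  [set [set v; f v] | v in [set~ rho]].

Lemma set2_eq (T : finType) (x y u v : T) :
  [set x; y] = [set u; v] -> (x = u /\ y = v) \/ (x = v /\ y = u).
Proof.
move=> E; have := set21 x y; have := set22 x y; rewrite E !inE.
have := set21 u v; have := set22 u v; rewrite -E !inE.
by case/orP=> /eqP ?; case/orP=> /eqP ?; case/orP=> /eqP ?; case/orP=> /eqP ?;
  subst; auto.
Qed.

Lemma mem_edges (V : finType) (G : sgraph V) (x y : V) :
  ([set x; y] \in edges G) = G x y.
Proof.
apply/imsetP/idP => [[[u v]]|xy]; last by exists (x, y); rewrite ?inE.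
rewrite inE /= => uv /set2_eq[[-> ->]//|[-> ->]].
by rewrite adj_sym.
Qed.

Lemma edgesP (V : finType) (G : sgraph V) (e : {set V}) :
  reflect (exists x y, G x y /\ e = [set x; y]) (e \in edges G).
Proof.
apply: (iffP idP) => [/imsetP[[x y]]|[x [y [xy ->]]]].
  by rewrite inE /= => xy ->; exists x, y.
by rewrite mem_edges.
Qed.

Lemma parent_edgesP (V : finType) (rho : V) (f : {ffun V -> V}) (x y : V) :
  reflect ((x != rho /\ y = f x) \/ (y != rho /\ x = f y))
          ([set x; y] \in parent_edges rho f).
Proof.
apply: (iffP imsetP) => [[v]|].
  by rewrite !inE => vr /set2_eq[] [-> ->]; [left|right].
case=> -[xr ->]; first by exists x; rewrite ?inE.
by exists y; rewrite ?inE // setUC.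
Qed.

Lemma rooted_tree (V : finType) (G : sgraph V) (rho : V) (f : {ffun V -> V}) :
  f \in rooted G rho ->
  parent_edges rho f \subset edges G /\
  is_tree (spanning_subgraph G (parent_edges rho f)).
Proof.
move=> fr; have [f0 fG [d dP]] := rootedP fr; split.
  apply/subsetP=> _ /imsetP[v vr ->]; rewrite mem_edges fG //.
  by move: vr; rewrite !inE.
set H := spanning_subgraph _ _.
have Hsym : connect_sym H by apply: sym_connect_sym; apply: adj_sym.
have Hv v : v != rho -> H v (f v).
  by move=> vr; rewrite /= fG //=; apply/parent_edgesP; left.
have HP u w : H u w -> [set u; w] \in parent_edges rho f by case/andP.
clearbody H.
have Hr v : connect H v rho.
  have [n] := ubnP (d v); elim: n v => // n IHn v ltvn.
  have [->|vNrho] := eqVneq v rho; first exact: connect0.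
  apply: connect_trans (connect1 (Hv v vNrho)) (IHn _ _).
  by apply: leq_trans (dP _ vNrho) _; rewrite -ltnS.
apply/andP; split.
  apply/forallP=> x; apply/forallP=> y; apply: connect_trans (Hr x) _.
  by rewrite Hsym.
apply/acyclicP=> c c3 /andP[cyc uc].
(* A vertex of maximal rank on a cycle would have two distinct neighbours on it,
   both equal to its parent. *)
have [v vc vmax] : exists2 v, v \in c & forall w, w \in c -> d w <= d v.
  case: c c3 {cyc uc} => // x c _.
  case: (@arg_maxnP _ x (mem (x :: c)) d); first by rewrite /= inE eqxx.
  by move=> v; exists v.
have nb w : w \in c -> H v w -> w = f v.
  move=> wc /HP/parent_edgesP[[_ ->]//|[wr vE]].
  by have := dP _ wr; rewrite -vE ltnNge vmax.
have [i p rp] := rot_to vc.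
have : path.cycle H (v :: p) by rewrite -rp rot_cycle.
have : uniq (v :: p) by rewrite -rp rot_uniq.
have : 2 < size (v :: p) by rewrite -rp size_rot.
have {}nb w : w \in v :: p -> H v w -> w = f v.
  by rewrite -rp mem_rot; apply: nb.
case: p rp nb => [//|a p] _ nb; case/lastP: p nb => [//|p b] nb _ /=.
case/and3P=> _ anb _; rewrite !rcons_path !last_rcons -!andbA.
case/and4P=> va _ _ bv.
have afv : a = f v by apply: (nb a _ va); rewrite !inE eqxx orbT.
have bfv : b = f v.
  by apply: nb; rewrite ?inE ?mem_rcons ?inE ?eqxx ?orbT // (adj_sym H).
by rewrite mem_rcons afv bfv mem_head in anb.
Qed.

(** Induction on the rank for [f]. If [g] used the edge from [v] to [f v] in the other direction,
    then [f (f v) = g (f v) = v] by induction, and the rank would decrease in a loop. *)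
Lemma rooted_inj (V : finType) (G : sgraph V) (rho : V) :
  {in rooted G rho &, injective (parent_edges rho)}.
Proof.
move=> f g fr gr E; have [f0 _ [d dP]] := rootedP fr.
have [g0 _ _] := rootedP gr; apply/ffunP => v.
have [n] := ubnP (d v); elim: n v => // n IHn v ltvn.
have [->|vr] := eqVneq v rho; first by rewrite f0 g0.
have : [set v; f v] \in parent_edges rho g.
  by rewrite -E; apply/parent_edgesP; left.
case/parent_edgesP=> [[_ //]|[fvr vE]].
have lt1 := dP v vr; have := dP _ fvr.
rewrite (IHn (f v)); last by apply: leq_trans lt1 _; rewrite -ltnS.
by rewrite -vE ltnNge ltnW.
Qed.

(** A parent function chosen inside F already gives a spanning tree; a further edge of F would close
    a cycle with the tree path between its ends. *)
Lemma tree_rooted (V : finType) (G : sgraph V) (rho : V) (F : {set {set V}}) :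
  F \subset edges G -> is_tree (spanning_subgraph G F) ->
  exists2 f, f \in rooted G rho & F = parent_edges rho f.
Proof.
move=> FG /andP[connF /acyclicP acF].
have [f fF] := connected_rooted rho connF.
have [f0 fG [d dP]] := rootedP fF.
have fr : f \in rooted G rho.
  by apply: (@rank_rooted _ _ _ _ d) => // v vr; have /andP[? _] := fG v vr; auto.
exists f => //; apply/eqP; rewrite eqEsubset andbC; apply/andP; split.
  apply/subsetP=> _ /imsetP[v vr ->].
  by rewrite !inE in vr; have /andP[] := fG v vr.
apply/subsetP=> e eF; have /edgesP[x [y [xy eE]]] := subsetP FG _ eF.
rewrite {}eE in eF *; apply/negPn/negP => eNp.
have [_ /andP[/forallP/(_ x)/forallP/(_ y)/connectP[p px ly] _]] := rooted_tree fr.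
case/shortenP: px ly => q pq uq _ ly.
have pqF : path (spanning_subgraph G F) x q.
  apply: sub_path pq => u v /= /andP[-> /=] /parent_edgesP[[ur ->]|[vr ->]].
    by have /andP[_] := fG u ur.
  by rewrite setUC; have /andP[_] := fG v vr.
apply: (acF (x :: q)); last first.
  by apply/andP; split=> //=; rewrite rcons_path pqF -ly /= adj_sym xy setUC eF.
case: q pq {uq pqF} ly => [_ /= yx|a [|//] /= /andP[/andP[_ xa] _] ya].
  by rewrite yx adj_irr in xy.
by rewrite ya xa in eNp.
Qed.

Lemma tau_rooted (V : finType) (G : sgraph V) (rho : V) :
  tau G = #|rooted G rho|.
Proof.
rewrite -(card_in_imset (@rooted_inj V G rho)); apply: eq_card => F.
rewrite inE; apply/andP/imsetP => [[FG tF]|[f fr ->]]; last exact: rooted_tree.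
by have [f] := tree_rooted rho FG tF; exists f.
Qed.

Lemma rooted_sub (V : finType) (G H : sgraph V) (rho : V) :
  subrel G H -> rooted G rho \subset rooted H rho.
Proof.
move=> GH; apply/subsetP=> f /rootedP[f0 fG [d dP]].
by apply: (@rank_rooted _ _ _ _ d) => // v vr; split; [apply: GH; apply: fG|exact: dP].
Qed.

Lemma tau_lt (V : finType) (G H : sgraph V) (x y : V) :
  subrel G H -> connected G -> H x y -> ~~ G x y -> tau G < tau H.
Proof.
move=> GH cG Hxy nGxy; rewrite !(tau_rooted _ x); apply: proper_card.
have [f fr] := connected_rooted x cG; have [f0 fG [d dP]] := rootedP fr.
rewrite properE rooted_sub //; apply/subsetPn.
have yx : y != x by apply: contraTneq Hxy => ->; rewrite adj_irr.
(* Hanging y directly below the root x uses the new edge. *)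
exists [ffun v => if v == y then x else f v].
  apply: (@rank_rooted _ _ _ _ (fun v => if v == x then 0 else (d v).+1)).
    by rewrite ffunE eq_sym (negPf yx).
  move=> v vx; rewrite ffunE (negPf vx); have [->|vy] := eqVneq v y.
    by rewrite eqxx adj_sym.
  by split; [apply: GH; apply: fG|case: ifP => // _; rewrite ltnS dP].
apply/negP=> /rootedP[_ /(_ y yx)]; rewrite ffunE eqxx adj_sym => Gxy _.
by rewrite Gxy in nGxy.
Qed.

(** * The matrix-tree theorem *)

Local Open Scope ring_scope.

(** Multilinearity in the rows: [f] selects one summand from each row. *)
Lemma det_row_sum (R : comNzRingType) (K : finType) (n : nat)
    (c : 'I_n -> K -> R) (d : 'I_n -> K -> 'I_n -> R) :
  \det (\matrix_(i, j) \sum_k c i k * d i k j) =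
  \sum_(f : {ffun 'I_n -> K})
     (\prod_i c i (f i)) * \det (\matrix_(i, j) d i (f i) j).
Proof.
rewrite /determinant; under [RHS]eq_bigr do rewrite mulr_sumr.
rewrite exchange_big; apply: eq_bigr => s _ /=.
under eq_bigr do rewrite mxE; rewrite bigA_distr_bigA mulr_sumr.
apply: eq_bigr => f _; rewrite big_split /= mulrCA; congr (_ * (_ * _)).
by apply: eq_bigr => i _; rewrite mxE.
Qed.

(** Row i is a sum of differences e_i - e_w over the neighbours w, the shape needed by
    [det_row_sum]; [laplacianE] recovers degree minus adjacency. *)
Definition laplacian (R : pzRingType) (V : finType) (G : sgraph V) : 'M[R]_#|V| :=
  \matrix_(i, j) \sum_w (G (enum_val i) w)%:R
                        * ((i == j)%:R - (w == enum_val j)%:R).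

(** The matrix is unitriangular once the vertices are ordered by rank. Working with the permutation
    expansion avoids choosing such an order. *)
Lemma det_parent_rooted (R : comNzRingType) (V : finType) (G : sgraph V) (rho : V)
    (f : {ffun V -> V}) : f \in rooted G rho ->
  \det (\matrix_(i < #|V|, j < #|V|)
     ((i == j)%:R - ((f (enum_val i) == enum_val j) && (enum_val i != rho))%:R : R))
  = 1.
Proof.
case/rootedP=> f0 _ [d dP]; rewrite /determinant (bigD1 1%g) //= odd_perm1 mul1r.
rewrite [X in _ + X]big1 ?addr0 => [|s s1].
  apply: big1 => i _; rewrite mxE perm1 eqxx; case: eqVneq => [fi|_]; last first.
    by rewrite subr0.
  case: (eqVneq (enum_val i) rho) => [_|/dP]; first by rewrite subr0.
  by rewrite fi ltnn.
have /existsP[i0 i0P] : [exists i, s i != i].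
  apply: contraNT s1 => /existsPn h; apply/eqP/permP => i; rewrite perm1.
  by apply/eqP/negPn/h.
(* A permutation other than 1 with nonzero contribution sends each moved point to
   its parent, which contradicts minimality of the rank. *)
case: (@arg_minnP _ i0 (fun i => s i != i) (fun i => d (enum_val i))) => //.
move=> i si imin; rewrite (bigD1 i) //= mxE eq_sym (negPf si).
case: eqVneq => [fi|_]; last by rewrite subr0 mul0r mulr0.
case: eqVneq => [_|ir]; first by rewrite subr0 mul0r mulr0.
have := imin (s i); rewrite -fi leqNgt dP // => /(_ _)/negP; case=> //.
by apply: contraNneq si => /perm_inj ->.
Qed.

(* Each row of the matrix is a sum, over the possible parents k of i, of the rows
   e_i - e_k (and of e_rho in row rho), so multilinearity turns the determinant
   into a sum over parent functions f.  The determinant attached to f is 1 when f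
   is rooted at rho; otherwise the indicator of the vertices from which rho is not
   reached is in the kernel. *)
Lemma tau_det (R : fieldType) (V : finType) (G : sgraph V) (rho : 'I_#|V|) :
  (tau G)%:R = \det (laplacian R G + delta_mx rho rho).
Proof.
set r := enum_val rho.
(* The root is not adjacent to itself, so in row [rho] the index [k = r] is free to carry the
   summand coming from [delta_mx rho rho]. *)
pose c i k : R := (G (enum_val i) k || (i == rho) && (k == r))%:R.
pose d (i : 'I_#|V|) k j : R :=
  (i == j)%:R - ((k == enum_val j) && ~~ ((i == rho) && (k == r)))%:R.
have -> : laplacian R G + delta_mx rho rho = \matrix_(i, j) \sum_k c i k * d i k j.
  apply/matrixP=> i j; rewrite !mxE (bigD1 r) //= [RHS](bigD1 r) //= addrAC.
  congr (_ + _); last first.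
    by apply: eq_bigr => k kr; rewrite /c /d (negPf kr) andbF orbF andbT.
  rewrite /c /d eqxx andbT; case: (eqVneq i rho) => [->|_] /=.
    by rewrite adj_irr mul0r add0r orbT andbF subr0 mul1r eq_sym.
  by rewrite orbF addr0 andbT.
rewrite det_row_sum (tau_rooted _ r).
pose h (f : {ffun V -> V}) : {ffun 'I_#|V| -> V} := [ffun i => f (enum_val i)].
rewrite (reindex h) /=; last first.
  exists (fun g => [ffun v => g (enum_rank v)]) => f _; apply/ffunP=> x.
    by rewrite !ffunE enum_rankK.
  by rewrite !ffunE enum_valK.
rewrite -[#|rooted G r|]sum1_card natr_sum big_mkcond /=; apply: eq_bigr => f _.
have [/forallP cf|] := boolP [forall i, G (enum_val i) (h f i)
                                  || (i == rho) && (h f i == r)]; last first.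
  rewrite negb_forall => /existsP[i ci].
  rewrite [X in _ = X * _](bigD1 i) //= {1}/c (negPf ci) !mul0r.
  case: ifP => // /rootedP[f0 fG _]; case/negP: ci; rewrite ffunE.
  case: (eqVneq i rho) => [->|ir]; first by rewrite f0 eqxx orbT.
  by rewrite fG ?(inj_eq enum_val_inj).
rewrite [X in _ = X * _]big1 ?mul1r => [|i _]; last by rewrite /c cf.
case: ifP => [fr|fNr].
  rewrite -(det_parent_rooted R fr); congr (\det _); apply/matrixP=> i j.
  rewrite !mxE /d ffunE (inj_eq enum_val_inj).
  case: (eqVneq i rho) => //= ->; have [-> _ _] := rootedP fr.
  by rewrite eqxx !andbF.
apply/esym/eqP; rewrite -det_tr.
(* The conjunct [f w == w] empties [Z] when [f] does not fix [r]; the kernel vector is then the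
   all-ones vector. *)
pose Z v := [exists w, fconnect f v w && ((f w == w) && (w == r))].
have Zf v : (v != r) || (f v != v) -> Z v = Z (f v).
  move=> vP; apply/existsP/existsP => -[w /andP[vw /andP[fw wr]]]; last first.
    by exists w; rewrite (connect_trans (fconnect1 f v) vw) fw.
  exists w; rewrite fw wr /= andbT.
  rewrite -(eqP (fw : f w == w)).
  by move: vw => /(iter_findex) <-; rewrite -iterS iterSr; apply: fconnect_iter.
apply/det0P; exists (\row_i (~~ Z (enum_val i))%:R).
  apply: contraFneq fNr => /rowP Z0.
  have {}Z0 v : Z v.
    have := Z0 (enum_rank v); rewrite !mxE enum_rankK; case: (Z v) => //= /eqP.
    by rewrite oner_eq0.
  have f0 : f r = r by have /existsP[w /andP[_ /andP[/eqP + /eqP E]]] := Z0 r; rewrite E.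
  rewrite inE f0 eqxx /=; apply/andP; split; apply/forallP=> v.
    apply/implyP=> vr; have := cf (enum_rank v).
    rewrite ffunE enum_rankK => /orP[//|/andP[/eqP E]].
    by rewrite /r -E enum_rankK eqxx in vr.
  by have /existsP[w /andP[vw /andP[_ /eqP E]]] := Z0 v; rewrite -E.
apply/rowP=> i; rewrite !mxE.
have E k : (\row_i0 (~~ Z (enum_val i0))%:R) 0 k * (\matrix_(i0, j) d i0 (h f i0) j)^T k i
   = (~~ Z (enum_val k))%:R * d i (f (enum_val i)) k.
  by rewrite !mxE ffunE.
rewrite (eq_bigr _ (fun k _ => E k)) {E} /d.
have [/andP[/eqP ir fi]|nir] := boolP ((i == rho) && (f (enum_val i) == r)).
  rewrite (bigD1 i) //= eqxx andbF subr0 mulr1 big1 => [|k ki]; last first.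
    by rewrite andbF subr0 eq_sym (negPf ki) mulr0.
  rewrite addr0; suff -> : Z (enum_val i) by [].
  have er : enum_val i = r by rewrite ir.
  by rewrite er in fi *; apply/existsP; exists r; rewrite connect0 fi eqxx.
have fi : f (enum_val i) != enum_val i.
  have := cf i; rewrite ffunE (negPf nir) orbF => Gf.
  by apply: contraTneq Gf => ->; rewrite adj_irr.
under eq_bigr do rewrite andbT mulrBr.
rewrite big_split /= sumrN (bigD1 i) //= eqxx mulr1 big1 ?addr0 => [|k ki]; last first.
  by rewrite eq_sym (negPf ki) mulr0.
rewrite (bigD1 (enum_rank (f (enum_val i)))) //= enum_rankK eqxx mulr1.
rewrite big1 ?addr0 => [|k ki]; last first.
  case: (eqVneq (f _) (enum_val k)) ki => [->|]; first by rewrite enum_valK eqxx.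
  by rewrite mulr0.
by rewrite -Zf ?fi ?orbT // subrr.
Qed.

(** * Determinant inequalities *)

(** Sylvester's identity: one block matrix has two block-triangular factorisations, whose
    determinants are the two sides. *)
Lemma det_1_add_mul (R : comNzRingType) (m k : nat) (A : 'M[R]_(m, k)) (B : 'M_(k, m)) :
  \det (1%:M + A *m B) = \det (1%:M + B *m A).
Proof.
have E1 : block_mx 1%:M (- A) B 1%:M
        = block_mx 1%:M 0 B 1%:M *m block_mx 1%:M (- A) 0 (1%:M + B *m A).
  rewrite mulmx_block !mul1mx !mul0mx ?mulmx0 !mulmx1 ?addr0 mulmxN addrC.
  by rewrite addrK.
have E2 : block_mx 1%:M (- A) B 1%:M
        = block_mx 1%:M (- A) 0 1%:M *m block_mx (1%:M + A *m B) 0 B 1%:M.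
  rewrite mulmx_block !mul1mx !mul0mx ?mulmx0 !mulmx1 ?add0r mulNmx.
  by rewrite addrK.
have : \det (block_mx 1%:M (- A) B 1%:M) = \det (block_mx 1%:M (- A) B 1%:M) by [].
rewrite {1}E2 E1 !det_mulmx !(det_lblock, det_ublock) !det1.
by rewrite !mul1r ?mulr1.
Qed.

(** Since the margins of L vanish, L + e e' becomes L + u e' and then L + u v on multiplication by
    rank-one perturbations of the identity, whose determinants are the sums of the entries of u and
    of v. *)
Lemma det_lap_rank1 (R : comNzRingType) (n : nat) (L : 'M[R]_n) (rho : 'I_n)
    (u : 'cV_n) (v : 'rV_n) :
  const_mx 1 *m L = 0 :> 'rV_n -> L *m const_mx 1 = 0 :> 'cV_n ->
  \det (L + u *m v)
    = (\sum_i u i 0) * (\sum_i v 0 i) * \det (L + delta_mx rho rho).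
Proof.
move=> L1 L2; set e : 'cV[R]_n := delta_mx rho 0; set e' : 'rV[R]_n := delta_mx 0 rho.
have eE : delta_mx rho rho = e *m e' by rewrite mul_delta_mx.
have s1 (w : 'cV[R]_n) : const_mx 1 *m w = (\sum_i w i 0)%:M :> 'M_1.
  rewrite [LHS]mx11_scalar; congr (_%:M); rewrite mxE.
  by apply: eq_bigr => i _; rewrite mxE mul1r.
have s2 (w : 'rV[R]_n) : w *m const_mx 1 = (\sum_i w 0 i)%:M :> 'M_1.
  rewrite [LHS]mx11_scalar; congr (_%:M); rewrite mxE.
  by apply: eq_bigr => i _; rewrite mxE mulr1.
have se : \sum_i e i 0 = 1.
  rewrite (bigD1 rho) //= big1 ?addr0 ?mxE ?eqxx // => i ir.
  by rewrite mxE (negPf ir).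
have se' : \sum_i e' 0 i = 1.
  rewrite (bigD1 rho) //= big1 ?addr0 ?mxE ?eqxx // => i ir.
  by rewrite mxE (negPf ir) andbF.
have sB (w : 'cV[R]_n) : \sum_i (w - e) i 0 = (\sum_i w i 0) - 1.
  by rewrite -se -sumrB; apply: eq_bigr => i _; rewrite !mxE.
have sB' (w : 'rV[R]_n) : \sum_i (w - e') 0 i = (\sum_i w 0 i) - 1.
  by rewrite -se' -sumrB; apply: eq_bigr => i _; rewrite !mxE.
have E1 : (1%:M + (u - e) *m const_mx 1) *m (L + e *m e') = L + u *m e'.
  rewrite mulmxDl mul1mx -mulmxA [const_mx 1 *m _]mulmxDr L1 add0r [const_mx 1 *m _]mulmxA s1 se.
  by rewrite mul1mx mulmxBl -addrA subrKC.
have E2 : (L + u *m e') *m (1%:M + const_mx 1 *m (v - e')) = L + u *m v.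
  rewrite mulmxDr mulmx1 mulmxA [_ *m const_mx 1]mulmxDl L2 add0r -[u *m e' *m _]mulmxA s2 se'.
  by rewrite mulmx1 mulmxBr -addrA subrKC.
rewrite -E2 -E1 !det_mulmx -eE (det_1_add_mul (u - e)) (det_1_add_mul _ (v - e')).
rewrite s1 s2 sB sB' -![1%:M + _%:M]raddfD /= !det_scalar1.
by rewrite !(addrC 1) !subrK; ring.
Qed.

(** * Positive definite matrices and Hadamard's inequality *)

Definition posdef (R : realFieldType) (n : nat) (A : 'M[R]_n) : Prop :=
  A^T = A /\ forall x : 'rV_n, x != 0 -> 0 < (x *m A *m x^T) 0 0.

Definition possemidef (R : realFieldType) (n : nat) (A : 'M[R]_n) : Prop :=
  A^T = A /\ forall x : 'rV_n, 0 <= (x *m A *m x^T) 0 0.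

Lemma possemidefD (R : realFieldType) (n : nat) (A B : 'M[R]_n) :
  possemidef A -> possemidef B -> possemidef (A + B).
Proof.
move=> [sA pA] [sB pB]; split; first by rewrite linearD /= sA sB.
by move=> x; rewrite mulmxDr mulmxDl mxE addr_ge0.
Qed.

Lemma possemidef_diag (R : realFieldType) (n : nat) (d : 'rV[R]_n) :
  (forall i, 0 <= d 0 i) -> possemidef (diag_mx d).
Proof.
move=> d0; split=> [|x]; first by rewrite tr_diag_mx.
rewrite mul_mx_diag mxE sumr_ge0 // => i _; rewrite !mxE mulrAC.
by rewrite mulr_ge0 // -expr2 sqr_ge0.
Qed.

Lemma possemidef_congr (R : realFieldType) (m n : nat) (A : 'M[R]_m) (C : 'M_(n, m)) :
  possemidef A -> possemidef (C *m A *m C^T).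
Proof.
move=> [sA pA]; split; first by rewrite !trmx_mul trmxK sA mulmxA.
by move=> x; rewrite !mulmxA -mulmxA -trmx_mul pA.
Qed.

Lemma sqr_norm_gt0 (R : realFieldType) (n : nat) (x : 'rV[R]_n) :
  x != 0 -> 0 < (x *m x^T) 0 0.
Proof.
move=> x0; rewrite mxE lt_def; apply/andP; split; last first.
  by apply: sumr_ge0 => i _; rewrite mxE -expr2 sqr_ge0.
apply: contraNneq x0; under eq_bigr do rewrite mxE -expr2.
move/eqP; rewrite psumr_eq0 => [/allP h|i _]; last exact: sqr_ge0.
apply/eqP/rowP=> i; rewrite mxE; apply/eqP; rewrite -sqrf_eq0.
by apply: (implyP (h i _)); rewrite ?mem_index_enum.
Qed.

Lemma posdef_1D (R : realFieldType) (n : nat) (A : 'M[R]_n) :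
  possemidef A -> posdef (1%:M + A).
Proof.
move=> [sA pA]; split; first by rewrite linearD /= trmx1 sA.
by move=> x x0; rewrite mulmxDr mulmxDl mxE mulmx1 ltr_pwDl // sqr_norm_gt0.
Qed.

Lemma posdef_diag (R : realFieldType) (n : nat) (A : 'M[R]_n) (i : 'I_n) :
  posdef A -> 0 < A i i.
Proof.
move=> [_ pA]; have d0 : delta_mx 0 i != 0 :> 'rV[R]_n.
  by apply/eqP=> /rowP/(_ i)/eqP; rewrite !mxE !eqxx oner_eq0.
by have := pA _ d0; rewrite trmx_delta -rowE -colE !mxE.
Qed.

(** Induction through the Schur complement [C] of the corner entry: it is again positive definite,
    and its diagonal is bounded by that of [D]. *)
Lemma hadamard (R : realFieldType) (n : nat) (A : 'M[R]_n) :
  posdef A -> 0 < \det A <= \prod_i A i i.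
Proof.
elim: n A => [|n IHn] A pA; first by rewrite det_mx00 big_ord0 ltr01 lexx.
move: A pA; rewrite -[n.+1]/(1 + n)%N => A [sA pA].
pose a := A 0 0; pose u := ursubmx A; pose D := drsubmx A.
have AE : A = block_mx a%:M u u^T D.
  rewrite -[LHS]submxK; congr block_mx.
    rewrite [LHS]mx11_scalar; congr (_%:M); rewrite !mxE /a.
    by congr (A _ _); apply: val_inj.
  by rewrite /u trmx_ursub sA.
have a_gt0 : 0 < a by apply: posdef_diag.
have an0 : a != 0 by rewrite gt_eqF.
pose C := D - a^-1 *: (u^T *m u).
have sD : D^T = D by rewrite /D trmx_drsub sA.
have pC : posdef C.
  split=> [|y y0]; first by rewrite linearB linearZ /= trmx_mul trmxK sD.
  (* This [x] kills the first coordinate of [row_mx x y *m A], so the form of [A] at this vector is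
     the form of [C] at [y]. *)
  pose x := - (a^-1 *: (y *m u^T)).
  have z0 : row_mx x y != 0.
    by apply: contraNneq y0; rewrite -[0]row_mx0 => /eq_row_mx[_ ->].
  have := pA _ z0; rewrite {1}AE mul_row_block tr_row_mx mul_row_col.
  have -> : x *m a%:M + y *m u^T = 0.
    by rewrite mul_mx_scalar scalerN scalerA divff // scale1r addNr.
  rewrite mul0mx add0r; congr (0 < (_ *m _) 0 0).
  by rewrite /x mulNmx -scalemxAl -mulmxA addrC mulmxBr -scalemxAr.
have detE : \det A = a * \det C.
  have : A *m block_mx 1%:M (- (a^-1 *: u)) 0 1%:M = block_mx a%:M 0 u^T C.
    rewrite {1}AE mulmx_block !mulmx1 !mulmx0 !addr0 mulmxN mul_scalar_mx.
    rewrite scalerA divff // scale1r addNr; congr block_mx.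
    by rewrite mulmxN -scalemxAr addrC.
  move/(congr1 determinant).
  by rewrite det_mulmx det_ublock !det1 !mulr1 det_lblock det_scalar1.
have /andP[C0 Cle] := IHn _ pC.
rewrite detE mulr_gt0 //= big_ord_recl ler_pM2l //.
apply: le_trans Cle _; apply: ler_prod => i _.
have DE : D i i = A (lift ord0 i) (lift ord0 i).
  by rewrite !mxE; congr (A _ _); apply: val_inj.
rewrite -DE; apply/andP; split; first exact/ltW/posdef_diag.
rewrite /C mxE [in X in _ + X]mxE gerDl oppr_le0 mxE mulr_ge0 ?invr_ge0 ?(ltW a_gt0) //.
by rewrite ?mxE big_ord1 [u^T _ _]mxE -expr2 sqr_ge0.
Qed.

Lemma det_le_trace (R : realFieldType) (n : nat) (A : 'M[R]_n) :
  posdef A -> \det A <= (\tr A / n%:R) ^+ n.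
Proof.
move=> pA; have /andP[_ Hle] := hadamard pA; apply: le_trans Hle _.
have := @leif_AGM R 'I_n predT (fun i => A i i).
by rewrite card_ord => -[|//] i _; apply/ltW/posdef_diag.
Qed.

(** The bordered determinant is - b c 1^T adj(1 + K) 1, which is - b c r times the determinant of 1
    + K compressed to the vectors of sum zero. Restoring the all-ones direction with eigenvalue
    [lam] multiplies the latter by [lam]; this is [D]. Its matrix has mean diagonal entry [lam]
    minus a positive multiple of the off-diagonal sum of K. *)
Lemma bordered_det_le (R : realFieldType) (r : nat) (K : 'M[R]_r) (lam b c : R) :
  (0 < r)%N -> possemidef K -> 1 <= lam -> b != 0 -> c != 0 ->
  (forall i, 1 + K i i = lam) -> (forall i j, i != j -> 0 <= K i j) ->
  exists D, \det (block_mx (1%:M + K) (const_mx b) (const_mx c) (0 : 'M_1))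
              = - (b * c * r%:R / lam) * D
         /\ D <= lam ^+ r ?= iff [forall i, forall j, (i != j) ==> (K i j == 0)].
Proof.
move=> r0 pK lam1 b0 c0 Kd Ko; set M := 1%:M + K.
have rn0 : r%:R != 0 :> R by rewrite pnatr_eq0 -lt0n.
have rp : 0 < r%:R :> R by rewrite ltr0n.
have lamp : 0 < lam by apply: lt_le_trans lam1.
have lam0 : lam != 0 by rewrite gt_eqF.
pose j : 'cV[R]_r := const_mx 1; pose j' : 'rV[R]_r := const_mx 1.
have jT : j^T = j' by apply/matrixP=> i k; rewrite !mxE.
have jj : j' *m j = r%:R%:M.
  rewrite [LHS]mx11_scalar; congr (_%:M); rewrite mxE.
  under eq_bigr do rewrite !mxE mulr1.
  by rewrite sumr_const card_ord.
(* Orthogonal projection onto the vectors of sum zero; on a Gram matrix it subtracts the mean of the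
   Gram vectors. *)
pose Pi := 1%:M - r%:R^-1 *: (j *m j').
have PiT : Pi^T = Pi.
  by rewrite /Pi linearB /= trmx1 linearZ /= trmx_mul -jT trmxK.
have Pij : Pi *m j = 0.
  rewrite mulmxBl mul1mx -scalemxAl -mulmxA jj mul_mx_scalar scalerA.
  by rewrite mulVf // scale1r subrr.
have PiPi : Pi *m Pi = Pi.
  by rewrite {2}/Pi mulmxBr mulmx1 -scalemxAr mulmxA Pij mul0mx scaler0 subr0.
(* M' has the same bordered determinant as M, but all-ones is now an eigenvector, of
   eigenvalue lam. *)
pose M' := Pi *m M *m Pi + (lam / r%:R) *: (j *m j').
have M'j : M' *m j = lam *: j.
  rewrite mulmxDl -mulmxA Pij mulmx0 add0r -scalemxAl -mulmxA jj mul_mx_scalar.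
  by rewrite scalerA divfK.
have pM' : posdef M'.
  (* As the identity is [Pi] plus the projection onto all-ones, splitting it off leaves [lam - 1],
     which is nonnegative, in the all-ones direction. *)
  have -> : M' = 1%:M + (Pi *m K *m Pi^T
                         + j *m diag_mx (const_mx ((lam - 1) / r%:R)) *m j^T).
    rewrite PiT jT /M' /M diag_const_mx mul_mx_scalar -scalemxAl.
    have -> : lam / r%:R = (lam - 1) / r%:R + r%:R^-1 by field.
    rewrite [Pi *m (1%:M + _)]mulmxDr mulmx1 [(Pi + _) *m Pi]mulmxDl PiPi.
    rewrite scalerDl [X in _ + X = _]addrC addrACA; congr (_ + _).
    by rewrite /Pi subrK.
  apply: posdef_1D; apply: possemidefD; apply: possemidef_congr => //.
  by apply: possemidef_diag => i; rewrite mxE divr_ge0 ?subr_ge0 ?(ltW rp).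
exists (\det M'); split.
  (* Because the corner is zero, multiples of the border row and column can be added to [M] without
     disturbing the border; [z] and [w] are the coefficients that produce [M']. The last factor of
     [E] clears the border column, using that all-ones is an eigenvector of [M']. *)
  clearbody M; pose z := - (c^-1 * r%:R^-1) *: (M *m j).
  pose w := b^-1 *: (- r%:R^-1 *: (j' *m M)
              + r%:R^-2 *: (j' *m M *m j *m j') + (lam / r%:R) *: j').
  have E : block_mx 1%:M z 0 1%:M *m block_mx M (const_mx b) (const_mx c) 0
      *m block_mx 1%:M 0 w 1%:M *m block_mx 1%:M (- (b / lam) *: j) 0 1%:M
      = block_mx M' 0 (const_mx c) (- (b * c * r%:R / lam))%:M.
    have -> : const_mx b = b *: j.
      by apply/matrixP=> ? ?; rewrite !mxE mulr1.
    have -> : const_mx c = c *: j' by apply/matrixP=> ? ?; rewrite !mxE mulr1.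
    rewrite !mulmx_block !mul1mx !mul0mx !mulmx0 !mulmx1 !addr0 !add0r.
    rewrite mul0mx addr0; have -> : M + z *m (c *: j') + b *: j *m w = M'.
      have -> : z *m (c *: j') = - (r%:R^-1 *: (M *m (j *m j'))).
        by rewrite /z -scalemxAr -scalemxAl scalerA mulrN mulrA mulfV // mul1r
                   scaleNr mulmxA.
      have -> : b *: j *m w = - (r%:R^-1 *: (j *m j' *m M))
          + r%:R^-2 *: (j *m j' *m M *m (j *m j')) + (lam / r%:R) *: (j *m j').
        by rewrite /w -scalemxAl -scalemxAr scalerA mulfV // scale1r !mulmxDr
                   -!scalemxAr scaleNr !mulmxA.
      rewrite /M'; have -> : Pi *m M *m Pi = M - r%:R^-1 *: (j *m j' *m M)
          - (r%:R^-1 *: (M *m (j *m j'))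
             - r%:R^-2 *: (j *m j' *m M *m (j *m j'))).
        rewrite mulmxBr mulmx1 -scalemxAr mulmxBl mul1mx -scalemxAl mulmxBl.
        by rewrite -scalemxAl scalerBr scalerA -expr2 exprVn.
      by rewrite opprB !addrA; congr (_ + _); rewrite [RHS]addrAC; congr (_ + _);
        rewrite addrAC.
    rewrite -scalemxAr M'j scalerA -mulNr divfK // scaleNr addNr.
    by rewrite -scalemxAl -scalemxAr jj scalerA scale_scalar_mx; congr block_mx;
      congr (_%:M); ring.
  move/(congr1 determinant): E.
  rewrite !det_mulmx !det_ublock !det_lblock !det1 !mulr1 !mul1r det_scalar1 mulrC.
  by move=> ->.
pose off := \sum_i \sum_(k | k != i) K i k.
have off0 : 0 <= off.
  by apply: sumr_ge0 => i _; apply: sumr_ge0 => k ki; rewrite Ko // eq_sym.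
have offE : (off == 0) = [forall i, forall j, (i != j) ==> (K i j == 0)].
  rewrite psumr_eq0 => [|i _]; last by apply: sumr_ge0 => k ki; rewrite Ko // eq_sym.
  apply/allP/forallP => [h i|h i _].
    have := h i (mem_index_enum i); rewrite /= psumr_eq0 => [/allP h'|k ki]; last first.
      by rewrite Ko // eq_sym.
    apply/forallP => k; apply/implyP => ki.
    by apply: (implyP (h' k (mem_index_enum k))); rewrite eq_sym.
  apply/eqP; rewrite /= big1 // => k ki.
  by have /forallP/(_ k) := h i; rewrite eq_sym ki => /eqP.
have trM : \tr M' / r%:R = lam - off / r%:R ^+ 2.
  rewrite linearD /= mxtrace_mulC mulmxA PiPi linearZ /= [\tr (j *m _)]mxtrace_mulC jj.
  rewrite /Pi mulmxBl mul1mx -scalemxAl linearB linearZ /=.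
  rewrite -mulmxA mxtrace_mulC -mulmxA.
  have -> : \tr M = r%:R * lam.
    rewrite /mxtrace (eq_bigr (fun=> lam)) => [|i _]; last by rewrite !mxE eqxx Kd.
    by rewrite sumr_const card_ord mulr_natl.
  have -> : \tr (j' *m (M *m j)) = r%:R * lam + off.
    rewrite /mxtrace big_ord1 mxE (eq_bigr (fun i => lam + \sum_(k | k != i) K i k)).
      by rewrite big_split /= sumr_const card_ord mulr_natl.
    move=> i _; rewrite !mxE mul1r (bigD1 i) //= !mxE eqxx Kd mulr1; congr (_ + _).
    by apply: eq_bigr => k ki; rewrite !mxE eq_sym (negPf ki) add0r mulr1.
  rewrite mxtrace_scalar /= mulr1n; field.
  by rewrite rn0.
have dle := det_le_trace pM'; rewrite trM in dle.
have base0 : 0 <= lam - off / r%:R ^+ 2.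
  rewrite -trM divr_ge0 ?(ltW rp) //; apply: sumr_ge0 => i _.
  exact/ltW/posdef_diag.
rewrite -offE; have [off00|offn0] := eqVneq off 0.
  have ME : M = lam%:M.
    apply/matrixP=> i k; rewrite !mxE; have [<-|ik] := eqVneq i k; first by rewrite Kd.
    rewrite add0r; move/eqP: off00; rewrite offE.
    by move=> /forallP/(_ i)/forallP/(_ k); rewrite ik => /eqP.
  suff -> : M' = lam%:M by rewrite det_scalar; split; rewrite ?lexx ?eqxx.
  rewrite /M' ME mul_mx_scalar -scalemxAl PiPi /Pi scalerBr scalerA subrK.
  by rewrite scalemx1.
have lt : \det M' < lam ^+ r.
  apply: le_lt_trans dle _; rewrite ltrXn2r ?gt_eqF //.
  by rewrite ltrBlDr ltrDl divr_gt0 ?exprn_gt0 // lt_def offn0.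
by split; [exact: ltW | rewrite lt_eqF].
Qed.

(** * Two cliques joined by cross edges *)

Lemma big_enum_valT (R : Type) (idx : R) (op : Monoid.com_law idx) (V : finType)
    (F : V -> R) : \big[op/idx]_(i < #|V|) F (enum_val i) = \big[op/idx]_v F v.
Proof.
rewrite [RHS](reindex (fun i : 'I_#|V| => enum_val i)) //.
by apply: onW_bij; apply: enum_val_bij.
Qed.

(* Each cross edge is listed once, oriented from A to its complement. *)
Definition cross (V : finType) (G : sgraph V) (A : {set V}) : {set V * V} :=
  [set p | [&& p.1 \in A, p.2 \notin A & G p.1 p.2]].

(** Comparing like components suffices for [cross]: first components lie in A and second ones
    outside it. *)
Definition disjoint_pairs (V : finType) (X : {set V * V}) : bool :=
  [forall p in X, forall q in X, (p != q) ==> (p.1 != q.1) && (p.2 != q.2)].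

Lemma sum_pred1 (R : pzRingType) (V : finType) (F : V -> R) (v : V) :
  \sum_w F w * (w == v)%:R = F v.
Proof.
rewrite (bigD1 v) //= eqxx mulr1 big1 ?addr0 // => w /negPf ->.
by rewrite mulr0.
Qed.

Lemma laplacianE (R : pzRingType) (V : finType) (G : sgraph V) (i j : 'I_#|V|) :
  laplacian R G i j = (\sum_w (G (enum_val i) w)%:R) * (i == j)%:R
                      - (G (enum_val i) (enum_val j))%:R.
Proof.
rewrite mxE; under eq_bigr do rewrite mulrBr.
by rewrite sumrB -mulr_suml sum_pred1.
Qed.

Lemma laplacian_margins (R : pzRingType) (V : finType) (G : sgraph V) :
  const_mx 1 *m laplacian R G = 0 :> 'rV_#|V| /\
  laplacian R G *m const_mx 1 = 0 :> 'cV_#|V|.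
Proof.
have s1 i : \sum_j laplacian R G i j = 0.
  under eq_bigr do rewrite laplacianE eq_sym.
  rewrite sumrB (sum_pred1 (fun=> \sum_w (G (enum_val i) w)%:R)).
  by rewrite (big_enum_valT _ (fun w => (G (enum_val i) w)%:R)) subrr.
have sym i j : laplacian R G i j = laplacian R G j i.
  rewrite !laplacianE; have [->//|ij] := eqVneq i j.
  by rewrite !mulr0 (adj_sym G).
split; apply/matrixP=> i j.
  rewrite mxE [RHS]mxE; transitivity (\sum_k laplacian R G j k); last exact: s1.
  by apply: eq_bigr => k _; rewrite [const_mx _ _ _]mxE mul1r sym.
rewrite mxE [RHS]mxE; transitivity (\sum_k laplacian R G i k); last exact: s1.
by apply: eq_bigr => k _; rewrite [const_mx _ _ _]mxE mulr1.
Qed.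

Lemma sum_cross (R : pzRingType) (V : finType) (X : {set V * V}) (F : V * V -> R) :
  \sum_(e < #|X|) F (enum_val e) = \sum_x \sum_y F (x, y) * ((x, y) \in X)%:R.
Proof.
rewrite -big_enum_val /= pair_bigA /= big_mkcond /=; apply: eq_bigr => -[x y] _ /=.
by case: ifP => _; rewrite ?mulr1 ?mulr0.
Qed.

Lemma sum_mem_set (R : pzRingType) (V : finType) (A : {set V}) :
  \sum_x (x \in A)%:R = #|A|%:R :> R.
Proof. by rewrite -sum1_card natr_sum [RHS]big_mkcond /=; apply: eq_bigr => x _; case: ifP. Qed.

(** The perturbed Laplacian is P (1 + Q [N uB] [N^T; vv]) with P diagonal, and Sylvester's identity
    exchanges the two factors. What remains is 1 + K bordered by the constants -1/b and 1/a + 1/b,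
    with a zero corner. *)
Lemma tau_two_cliques_det (R : realFieldType) (V : finType) (G : sgraph V)
    (A : {set V}) :
  let a : R := #|A|%:R in let b : R := #|~: A|%:R in let X := cross G A in
  let lam := 1 + a^-1 + b^-1 in
  (0 < #|A|)%N -> (0 < #|~: A|)%N -> (0 < #|X|)%N ->
  (forall x y, (x \in A) = (y \in A) -> G x y = (x != y)) ->
  exists D, (tau G)%:R * (a * b) ^+ 2 * lam
            = a ^+ #|A| * b ^+ #|~: A| * #|X|%:R * D
         /\ D <= lam ^+ #|X| ?= iff disjoint_pairs X.
Proof.
move=> a b X lam A0 B0 X0 GA.
have a0 : 0 < a by rewrite ltr0n.
have b0 : 0 < b by rewrite ltr0n.
have an0 : a != 0 by rewrite gt_eqF.
have bn0 : b != 0 by rewrite gt_eqF.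
have cX q : (q \in X) = [&& q.1 \in A, q.2 \notin A & G q.1 q.2] by rewrite inE.
have [v0 v0A] := card_gt0P A0.
pose p (v : V) : R := if v \in A then a else b.
have p0 v : p v != 0 by rewrite /p; case: ifP.
pose P : 'M[R]_#|V| := diag_mx (\row_i p (enum_val i)).
pose Q : 'M[R]_#|V| := diag_mx (\row_i (p (enum_val i))^-1).
have PQ : P *m Q = 1%:M.
  rewrite mul_diag_mx; apply/matrixP=> i j; rewrite !mxE.
  by case: eqVneq => [->|_]; rewrite ?mulr0n ?mulr0 // mulr1n divff.
pose N : 'M[R]_(#|V|, #|X|) := \matrix_(i, e)
  ((enum_val i == (enum_val e).1)%:R - (enum_val i == (enum_val e).2)%:R).
pose uB : 'cV[R]_#|V| := \col_i (enum_val i \notin A)%:R.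
pose vv : 'rV[R]_#|V| := \row_i ((enum_val i \in A)%:R - (enum_val i \notin A)%:R).
pose rA : 'rV[R]_#|V| := \row_i (enum_val i \in A)%:R.
(* N is the incidence matrix of the cross edges; P + N N^T exceeds the Laplacian by
   the two rank-one matrices of the sides, and adding const_mx 1 *m rA leaves only
   one of rank one to be absorbed. *)
have E1 : laplacian R G + const_mx 1 *m rA = P + row_mx N uB *m col_mx N^T vv.
  rewrite mul_row_col; apply/matrixP=> i j; rewrite [LHS]mxE [RHS]mxE [X in _ + X]mxE.
  rewrite big_ord1 [const_mx _ _ _]mxE mul1r [rA _ _]mxE laplacianE.
  rewrite [X in _ = X + _]mxE [(\row_i _) _ _]mxE [X in _ = _ + X]mxE [X in _ + (X + _)]mxE.
  rewrite [X in _ = _ + (_ + X)]mxE big_ord1 [uB _ _]mxE [vv _ _]mxE.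
  under [X in _ + (X + _)]eq_bigr do rewrite [N^T _ _]mxE !mxE.
  rewrite (sum_cross X (fun q => ((enum_val i == q.1)%:R - (enum_val i == q.2)%:R)
                       * ((enum_val j == q.1)%:R - (enum_val j == q.2)%:R))) /=.
  rewrite -(inj_eq enum_val_inj).
  set u := enum_val i; set v := enum_val j.
  pose Z x y : R := ((x, y) \in X)%:R.
  (* Adjacency is the two cliques, minus the diagonal, plus each cross edge in both orientations. *)
  have GE x y : (G x y)%:R = (x \in A)%:R * (y \in A)%:R
      + (x \notin A)%:R * (y \notin A)%:R - (y == x)%:R + Z x y + Z y x :> R.
    rewrite /Z !cX /= [G y x]adj_sym; have [xy|] := eqVneq (x \in A) (y \in A).
      rewrite GA // xy eq_sym.
      by case: (y \in A); case: (y == x); rewrite /= ?andbF; ring.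
    have [->|_] := eqVneq y x; first by rewrite eqxx.
    by case: (x \in A); case: (y \in A); case: (G x y) => // _ /=; ring.
  have -> : \sum_w (G u w)%:R = (u \in A)%:R * a + (u \notin A)%:R * b - 1
      + \sum_w Z u w + \sum_w Z w u.
    under eq_bigr do rewrite GE; rewrite !big_split /= sumrN -!mulr_sumr.
    have -> : \sum_y (y \notin A)%:R = b.
      by rewrite /b -sum_mem_set; apply: eq_bigr => y _; rewrite in_setC.
    have -> : \sum_w (w == u)%:R = 1 :> R.
      by rewrite -[RHS](sum_pred1 (fun=> 1) u); apply: eq_bigr => w _; rewrite mul1r.
    by rewrite sum_mem_set.
  have S1 : \sum_x \sum_y Z x y * (x == v)%:R * (x == u)%:R
            = (\sum_y Z u y) * (u == v)%:R.
    rewrite mulr_suml -(sum_pred1 (fun x => \sum_y Z x y * (x == v)%:R)).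
    by apply: eq_bigr => x _; rewrite mulr_suml.
  have S2 : \sum_x \sum_y Z x y * (y == v)%:R * (y == u)%:R
            = (\sum_y Z y u) * (u == v)%:R.
    by rewrite mulr_suml; apply: eq_bigr => x _;
       rewrite (sum_pred1 (fun y => Z x y * (y == v)%:R)).
  have S3 s t : \sum_x \sum_y Z x y * (y == t)%:R * (x == s)%:R = Z s t.
    rewrite -(sum_pred1 (fun y => Z s y)) -(sum_pred1 (fun x => \sum_y Z x y * (y == t)%:R)).
    by apply: eq_bigr => x _; rewrite mulr_suml.
  have -> : \sum_x \sum_y ((u == x)%:R - (u == y)%:R) * ((v == x)%:R - (v == y)%:R)
                * ((x, y) \in X)%:R
          = (\sum_y Z u y) * (u == v)%:R + (\sum_y Z y u) * (u == v)%:R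
            - Z u v - Z v u.
    rewrite -S1 -S2 -(S3 u v) -(S3 v u) -big_split -!sumrB /=; apply: eq_bigr => x _.
    rewrite -big_split -!sumrB /=; apply: eq_bigr => y _; rewrite -/(Z x y).
    by rewrite ![u == _]eq_sym ![v == _]eq_sym; ring.
  rewrite GE /p [v == u]eq_sym; case: eqVneq => [<-|_].
    by case: (u \in A); rewrite /=; ring.
  by case: (u \in A); case: (v \in A); rewrite /=; ring.
have sumN (g : V -> R) e : \sum_i g (enum_val i) * N i e
    = g (enum_val e).1 - g (enum_val e).2.
  under eq_bigr do rewrite mxE.
  rewrite (big_enum_valT _ (fun w => g w * ((w == (enum_val e).1)%:R
                                            - (w == (enum_val e).2)%:R))).
  by under eq_bigr do rewrite mulrBr; rewrite sumrB !sum_pred1.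
have eX (e : 'I_#|X|) : [/\ (enum_val e).1 \in A, (enum_val e).2 \notin A
               & G (enum_val e).1 (enum_val e).2].
  by apply/and3P; rewrite -cX enum_valP.
pose K := N^T *m Q *m N.
have pK : possemidef K.
  rewrite /K -{2}[N]trmxK; apply: possemidef_congr; apply: possemidef_diag => i.
  by rewrite mxE invr_ge0 /p; case: ifP => _; apply: ltW.
have KE e f : K e f = ((enum_val e).1 == (enum_val f).1)%:R / a
                    + ((enum_val e).2 == (enum_val f).2)%:R / b.
  rewrite /K -mulmxA mxE.
  have [eA eB _] := eX e; have [fA fB _] := eX f.
  pose g v : R := (p v)^-1 * ((v == (enum_val f).1)%:R - (v == (enum_val f).2)%:R).
  have E i : N^T e i * (Q *m N) i f = g (enum_val i) * N i e.
    by rewrite mul_diag_mx !mxE mulrC.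
  rewrite (eq_bigr _ (fun i _ => E i)) sumN /g /p eA (negPf eB).
  have -> : ((enum_val e).1 == (enum_val f).2) = false.
    by apply: contraNF fB => /eqP <-.
  have -> : ((enum_val e).2 == (enum_val f).1) = false.
    by apply: contraNF eB => /eqP ->.
  by rewrite subr0 sub0r mulrN opprK ![_^-1 * _]mulrC.
have W1 : N^T *m (Q *m uB) = const_mx (- b^-1).
  apply/matrixP=> e k; rewrite mxE [RHS]mxE.
  have [eA eB _] := eX e.
  pose g v : R := (p v)^-1 * (v \notin A)%:R.
  have E i : N^T e i * (Q *m uB) i k = g (enum_val i) * N i e.
    by rewrite mul_diag_mx !mxE mulrC.
  rewrite (eq_bigr _ (fun i _ => E i)) sumN /g /p eA eB (negPf eB).
  by rewrite mulr0 mulr1 sub0r.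
have W2 : vv *m (Q *m N) = const_mx (a^-1 + b^-1).
  apply/matrixP=> k e; rewrite mxE [RHS]mxE.
  have [eA eB _] := eX e.
  pose g v : R := (p v)^-1 * ((v \in A)%:R - (v \notin A)%:R).
  have E i : vv k i * (Q *m N) i e = g (enum_val i) * N i e.
    by rewrite mul_diag_mx !mxE /g; ring.
  rewrite (eq_bigr _ (fun i _ => E i)) sumN /g /p eA eB (negPf eB).
  by rewrite subr0 sub0r mulr1 mulrN1 opprK.
(* This -1 cancels the 1 of the identity and makes the corner of the bordered matrix zero. *)
have W3 : vv *m (Q *m uB) = (-1)%:M.
  rewrite [LHS]mx11_scalar mxE; congr (_%:M).
  transitivity (\sum_(v : V) (- b^-1) * (v \in ~: A)%:R).
    rewrite -(big_enum_valT _ (fun v => - b^-1 * (v \in ~: A)%:R)) /=.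
    apply: eq_bigr => i _; rewrite mul_diag_mx !mxE in_setC /p.
    by case: ifP => _ /=; rewrite ?mulr0 // mulr1 sub0r mulN1r mulr1.
  by rewrite -mulr_sumr sum_mem_set mulNr mulVf.
have detP : \det P = a ^+ #|A| * b ^+ #|~: A|.
  rewrite det_diag; under eq_bigr do rewrite mxE.
  rewrite (big_enum_valT _ p) (bigID (mem A)) /=; congr (_ * _).
    by rewrite (eq_bigr (fun=> a)) ?prodr_const // => v vA; rewrite /p vA.
  rewrite (eq_bigr (fun=> b)) => [|v /negPf vA]; last by rewrite /p vA.
  by rewrite prodr_const; congr (_ ^+ _); apply: eq_card => v; rewrite !inE.
have [lm1 lm2] := laplacian_margins R G.
have := det_lap_rank1 (enum_rank v0) (const_mx 1) rA lm1 lm2.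
rewrite -tau_det E1.
have -> : P + row_mx N uB *m col_mx N^T vv
        = P *m (1%:M + Q *m row_mx N uB *m col_mx N^T vv).
  by rewrite mulmxDr mulmx1 !mulmxA PQ mul1mx.
rewrite det_mulmx detP det_1_add_mul mul_mx_row mul_col_row W1 W2 W3 mulmxA -/K.
rewrite scalar_mx_block add_block_mx !add0r -raddfD subrr raddf0.
have lamE e : 1 + K e e = lam by rewrite KE !eqxx !div1r addrA.
have Koff e f : e != f -> 0 <= K e f.
  by move=> _; rewrite KE addr_ge0 // divr_ge0 ?ler0n // ltW.
have lam1 : 1 <= lam by rewrite /lam -addrA lerDl addr_ge0 // invr_ge0 ltW.
have lamn0 : lam != 0 by rewrite gt_eqF // (lt_le_trans ltr01).
have ab0 : a + b != 0 by rewrite gt_eqF // addr_gt0.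
have b'0 : - b^-1 != 0 by rewrite oppr_eq0 invr_eq0.
have c0 : a^-1 + b^-1 != 0 by rewrite gt_eqF // addr_gt0 ?invr_gt0.
have [D [DE Dle]] := bordered_det_le X0 pK lam1 b'0 c0 lamE Koff.
rewrite DE => E.
exists D; split; last first.
  rewrite (_ : disjoint_pairs X = [forall i, forall j, (i != j) ==> (K i j == 0)]) //.
  have K0 e f : (K e f == 0) = ((enum_val e).1 != (enum_val f).1)
                               && ((enum_val e).2 != (enum_val f).2).
    rewrite KE paddr_eq0 ?mulr_ge0 ?invr_ge0 ?(ltW a0) ?(ltW b0) //.
    by rewrite !mulf_eq0 !invr_eq0 (negPf an0) (negPf bn0) !orbF !pnatr_eq0 !eqb0.
  apply/forall_inP/forallP => [h e|h q qX].
    apply/forallP=> f; apply/implyP=> ef; rewrite K0.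
    have /forall_inP/(_ _ (enum_valP f)) := h _ (enum_valP e).
    by rewrite (inj_eq enum_val_inj) ef.
  apply/forall_inP => q' q'X; apply/implyP => qq'.
  have /forallP/(_ (enum_rank_in qX q')) := h (enum_rank_in qX q).
  rewrite K0 !enum_rankK_in // => /implyP; apply.
  by apply: contraNneq qq' => /(congr1 enum_val); rewrite !enum_rankK_in // => ->.
have s1 : \sum_i (const_mx 1 : 'cV[R]_#|V|) i 0 = a + b.
  under eq_bigr do rewrite mxE.
  by rewrite sumr_const card_ord -(cardsC A) natrD.
have s2 : \sum_i rA 0 i = a.
  under eq_bigr do rewrite mxE.
  by rewrite (big_enum_valT _ (fun v => (v \in A)%:R)) sum_mem_set.
rewrite s1 s2 in E.
(* The factor a + b occurs on both sides: as the sum of the all-ones column, and in the border entry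
   1/a + 1/b = (a + b)/(ab). *)
apply: (mulfI ab0).
transitivity ((a + b) * a * (tau G)%:R * (a * b ^+ 2 * lam)); first by ring.
rewrite -E; field.
by rewrite lamn0 an0 bn0.
Qed.

Local Close Scope ring_scope.

(** This is r a^(a-2) b^(b-2) (1 + 1/a + 1/b)^(r-1) with denominators cleared; no subtraction
    truncates when 0 < r < a and r < b. *)
Definition tau_bound (r a b : nat) : nat :=
  r * b ^ (b - r - 1) * a ^ (a - r - 1) * (b * a + (a + b)) ^ (r - 1).

(** Over the rationals, multiplication by [C] turns [tau G] into [C' * D] and the bound into
    [C' * lam ^+ r], so only [D] and [lam ^+ r] are left to compare. *)
Lemma tau_two_cliques (V : finType) (G : sgraph V) (A : {set V}) :
  let r := #|cross G A| in
  0 < r -> r < #|A| -> r < #|~: A| ->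
  (forall x y, (x \in A) = (y \in A) -> G x y = (x != y)) ->
  tau G <= tau_bound r #|A| #|~: A| ?= iff disjoint_pairs (cross G A).
Proof.
move=> r r0 ra rb GA.
have [k [ak ak']] : exists k, #|A| = r + k.+1 /\ #|A| - r - 1 = k.
  by exists (#|A| - r.+1); clear -ra; lia.
have [l [bl bl']] : exists l, #|~: A| = r + l.+1 /\ #|~: A| - r - 1 = l.
  by exists (#|~: A| - r.+1); clear -rb; lia.
have A0 : 0 < #|A| by apply: leq_trans ra.
have B0 : 0 < #|~: A| by apply: leq_trans rb.
have [D [DE Dle]] := @tau_two_cliques_det rat V G A A0 B0 r0 GA.
move: (disjoint_pairs _) Dle => c [Dle Deq].
rewrite -/r in DE Dle Deq; move: #|A| #|~: A| ra rb ak ak' bl bl' A0 B0 DE Dle Deq.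
move: (tau G) => t a b ra rb ak ak' bl bl' A0 B0; rewrite -/r => DE Dle Deq.
clearbody r; clear G A GA V.
have a0 : (0 < a%:R :> rat)%R by rewrite ltr0n.
have b0 : (0 < b%:R :> rat)%R by rewrite ltr0n.
have an0 : (a%:R != 0 :> rat)%R by rewrite gt_eqF.
have bn0 : (b%:R != 0 :> rat)%R by rewrite gt_eqF.
set lam := (1 + _ + _)%R in DE Dle Deq.
have lam0 : (0 < lam)%R by rewrite !addr_gt0 // invr_gt0.
set C := ((a%:R * b%:R) ^+ 2 * lam)%R.
have C0 : (0 < C)%R by rewrite !mulr_gt0.
set C' := (a%:R ^+ a * b%:R ^+ b * r%:R : rat)%R.
have C'0 : (0 < C')%R by rewrite !mulr_gt0 ?exprn_gt0 // ltr0n.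
have tE : (t%:R * C = C' * D)%R by rewrite mulrA.
have FE : ((tau_bound r a b)%:R * C = C' * lam ^+ r)%R.
  rewrite /C /C' /tau_bound !natrM !natrX natrD natrM natrD.
  have -> : lam = ((b%:R * a%:R + (a%:R + b%:R)) / (a%:R * b%:R))%R.
    by rewrite /lam; field; rewrite an0 bn0.
  rewrite ak' bl'.
  clear ak' bl'; move: (a%:R)%R (b%:R)%R an0 bn0 => x y xn0 yn0.
  rewrite {}ak {}bl; case: r {DE Dle Deq ra rb C' C'0 tE} r0 => // s _.
  rewrite subn1 /= expr_div_n exprMn !exprD !exprS !exprMn; field.
  by rewrite xn0 yn0 !expf_neq0.
split.
  by rewrite -(ler_nat rat) -(ler_pM2r C0) tE FE ler_pM2l.
by rewrite -(eqr_nat rat) -(inj_eq (mulIf (lt0r_neq0 C0))) tE FE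
           (inj_eq (mulfI (lt0r_neq0 C'0))) Deq.
Qed.

(** * Optimising the sizes of the two sides *)

(** Bernoulli's inequality (1 - 1/(z+1))^k >= 1 - k/(z+1), multiplied by (z+1)^(k+1). *)
Lemma bernoulli_nat (z k : nat) : z.+1 ^ k.+1 <= z.+1 * z ^ k + k * z.+1 ^ k.
Proof.
elim: k => [|k IHk]; first by rewrite expn0 expn1; lia.
have h : z ^ k <= z.+1 ^ k by case: k {IHk} => // k; rewrite leq_exp2r.
rewrite expnS [z ^ k.+1]expnS; apply: leq_trans (leq_mul (leqnn z.+1) IHk) _.
rewrite [z.+1 ^ k.+1]expnS; move: (z ^ k) (z.+1 ^ k) h => s t h; nia.
Qed.

(* (m+1)^(m-1) / m^(m-2) increases with m; here m = k + 2. *)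
Lemma pow_ratio_step (k : nat) : k.+3 ^ k.+1 * k.+3 ^ k.+1 < k.+4 ^ k.+2 * k.+2 ^ k.
Proof.
have E : k.+4 ^ k.+2 * k.+2 ^ k = k.+4 ^ 2 * (k.+4 * k.+2) ^ k.
  by rewrite expnMn mulnA -expnD.
(* Bernoulli is applied with z = (k+2)(k+4), one less than the square of k+3. *)
have y1 : (k.+4 * k.+2).+1 = k.+3 ^ 2 by rewrite -mulnn; lia.
have := bernoulli_nat (k.+4 * k.+2) k; rewrite y1 E => h.
rewrite -expnD addnn -muln2 mulnC expnM.
have t0 : 0 < (k.+3 ^ 2) ^ k by rewrite !expn_gt0.
rewrite -(ltn_pmul2l (_ : 0 < k.+3 ^ 2)) ?expn_gt0 //.
move: h; rewrite expnS; move: ((k.+4 * k.+2) ^ k) ((k.+3 ^ 2) ^ k) t0 => s t t0 h.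
have h2 : k.+4 ^ 2 * (k.+3 ^ 2 * t) <= k.+4 ^ 2 * (k.+3 ^ 2 * s + k * t).
  by rewrite leq_mul2l h orbT.
have h3 : k.+3 ^ 2 * k.+3 ^ 2 + k.+4 ^ 2 * k < k.+4 ^ 2 * k.+3 ^ 2 by nia.
have h4 : (k.+3 ^ 2 * k.+3 ^ 2 + k.+4 ^ 2 * k) * t < k.+4 ^ 2 * k.+3 ^ 2 * t.
  by rewrite ltn_pmul2r.
nia.
Qed.

(** Telescoping: the inductive inequality is multiplied by the next step and the common factor is
    cancelled. *)
Lemma pow_ratio_lt (k j : nat) : let l := (k + j).+1 in
  l.+2 ^ l * k.+3 ^ k.+1 < l.+3 ^ l.+1 * k.+2 ^ k.
Proof.
elim: j => [|j IHj]; first by rewrite /= addn0; apply: pow_ratio_step.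
rewrite /= addnS in IHj *; set l := (k + j).+1 in IHj *.
have := pow_ratio_step l => st.
have p0 : 0 < l.+3 ^ l.+1 * l.+2 ^ l by rewrite muln_gt0 !expn_gt0.
rewrite -(ltn_pmul2l p0).
have := ltn_mul IHj st; congr (_ < _); ring.
Qed.

(* In this form both a^(a-2) b^(b-2) and 1 + (a+b)/(ab) grow as a and b move apart
   with a + b fixed. *)
Lemma tau_boundE (r a b : nat) : 0 < r -> r < a -> r < b ->
  tau_bound r a b * (a * b) ^ (r - 1)
  = r * (a ^ (a - 2) * b ^ (b - 2)) * (b * a + (a + b)) ^ (r - 1).
Proof.
move=> r0 ra rb; rewrite /tau_bound expnMn.
have -> : a - 2 = (a - r - 1) + (r - 1) by lia.
have -> : b - 2 = (b - r - 1) + (r - 1) by lia.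
by rewrite !expnD; ring.
Qed.

Lemma tau_bound_step (r a d : nat) : 0 < r -> r < d -> d < a ->
  tau_bound r a d.+1 < tau_bound r a.+1 d.
Proof.
move=> r0 rd da.
have ra : r < a by apply: ltn_trans da.
have E1 := tau_boundE r0 ra (ltnW rd : r < d.+1).
have E2 := tau_boundE r0 (ltnW ra : r < a.+1) rd.
have d0 : 0 < d by apply: leq_trans rd.
have a0 : 0 < a by apply: leq_trans da.
have p1 : 0 < (a * d.+1) ^ (r - 1) by rewrite expn_gt0 muln_gt0 a0.
have p2 : 0 < (a.+1 * d) ^ (r - 1) by rewrite expn_gt0 muln_gt0 d0.
rewrite -(ltn_pmul2r p1) -(ltn_pmul2r p2) E1 [X in _ < X]mulnAC E2.
have core : a ^ (a - 2) * d.+1 ^ (d.+1 - 2) < a.+1 ^ (a.+1 - 2) * d ^ (d - 2).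
  have [k dk] : exists k, d = k.+2 by exists (d - 2); clear -r0 rd; lia.
  have [j aj] : exists j, a = (k + j).+1.+2.
    by exists (a - k - 3); clear -dk da; lia.
  have := pow_ratio_lt k j; rewrite /= aj dk.
  by rewrite !subSS !subn0.
clear E1 E2 p1 p2.
move: (_ * d.+1 ^ _) (_ * d ^ _) core => p q pq.
rewrite -!mulnA !(ltn_pmul2l r0) -!expnMn.
(* The exponent is zero when r = 1, so strictness comes from [p < q]; the other factor only needs to
   grow weakly, by d(a+1) <= a(d+1). *)
apply: (@leq_ltn_trans (p * ((d * a.+1 + (a.+1 + d)) * (a * d.+1)) ^ (r - 1))).
  rewrite leq_mul2l; apply/orP; right; case: (r - 1) => // e.
  by rewrite leq_exp2r //; clear -da; nia.
by rewrite ltn_pmul2r // expn_gt0 !muln_gt0 !addn_gt0 a0 orbT.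
Qed.

Lemma tau_bound_max (r d a b : nat) : 0 < r -> r < d -> d <= b -> b <= a ->
  tau_bound r a b <= tau_bound r (a + b - d) d ?= iff (b == d).
Proof.
move=> r0 rd; move: {2}(b - d) (leqnn (b - d)) => k.
elim: k a b => [|k IHk] a b bk db ba.
  have -> : b = d by lia.
  by rewrite addnK eqxx; apply: leqif_refl.
have [->|bd] := eqVneq b d; first by rewrite addnK; apply: leqif_refl.
suff lt : tau_bound r a b < tau_bound r (a + b - d) d.
  by split; [apply: ltnW|rewrite ltn_eqF].
case: b => [|b] in bk db ba bd *; first by lia.
apply: leq_trans (tau_bound_step _ _ _) _ => //; try lia.
have [+ _] := IHk a.+1 b ltac:(lia) ltac:(lia) ltac:(lia).
by rewrite addSnnS.
Qed.

(** * Edge cuts and the extremal graph *)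

Lemma cross_pair_inj (V : finType) (G : sgraph V) (A : {set V}) :
  {in cross G A &, injective (fun p : V * V => [set p.1; p.2])}.
Proof.
move=> [x y] [u v]; rewrite !inE /= => /and3P[xA yA _] /and3P[uA vA _].
case/set2_eq=> -[E1 E2]; first by rewrite E1 E2.
by rewrite -E1 xA in vA.
Qed.

(** Once the cross edges are deleted, A is closed under adjacency and no path leaves it. *)
Lemma edge_connectivity_cross (V : finType) (G : sgraph V) (A : {set V}) :
  0 < #|A| -> 0 < #|~: A| -> edge_connectivity G <= #|cross G A|.
Proof.
move=> /card_gt0P[x xA] /card_gt0P[y yB].
have V1 : 1 < #|V|.
  apply/card_gt1P; exists x, y; split=> //; apply: contraTneq yB => <-.
  by rewrite inE xA.
have [_ +] := (edge_connectivityP G (edge_connectivity G) V1).1 erefl.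
pose W := [set [set p.1; p.2] | p in cross G A].
have cW : #|W| = #|cross G A| by apply: card_in_imset; apply: cross_pair_inj.
rewrite -cW; apply.
  apply/subsetP=> e /imsetP[[u v]]; rewrite inE /= => /and3P[_ _ uv] ->.
  by rewrite mem_edges.
apply/negP => /forallP/(_ x)/forallP/(_ y); rewrite inE in yB; apply/negP.
apply: contra yB => xy; rewrite -(_ : (x \in A) = (y \in A)) //.
apply: (closed_connect _ xy) => u v /= /andP[uv]; rewrite in_setD => /andP[nW _].
apply/idP/idP => [uA|vA]; apply: contraR nW => nA.
  by apply/imsetP; exists (u, v); rewrite ?inE /= ?uA ?nA.
by apply/imsetP; exists (v, u); rewrite ?inE /= ?vA ?nA 1?adj_sym //= setUC.
Qed.

(** A is a component left by a minimum disconnecting set U, so every cross edge of A lies in U. *)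
Lemma edge_connectivity_cut (V : finType) (G : sgraph V) :
  1 < #|V| -> exists A : {set V},
  [/\ 0 < #|A|, 0 < #|~: A| & #|cross G A| = edge_connectivity G].
Proof.
move=> V1; have [[U [UG nconn cU]] _] := (edge_connectivityP G _ V1).1 erefl.
move: nconn; rewrite negb_forall => /existsP[x]; rewrite negb_forall => /existsP[y nxy].
pose A := [set z | connect (del_edges G U) x z].
have xA : x \in A by rewrite inE connect0.
have yB : y \in ~: A by rewrite !inE.
have A0 : 0 < #|A| by apply/card_gt0P; exists x.
have B0 : 0 < #|~: A| by apply/card_gt0P; exists y.
exists A; split=> //; apply/eqP; rewrite eqn_leq edge_connectivity_cross // andbT.
rewrite -cU -(card_in_imset (@cross_pair_inj V G A)); apply: subset_leq_card.
apply/subsetP=> e /imsetP[[u v]]; rewrite !inE /= => /and3P[xu nxv uv] ->.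
apply: contraR nxv => nU; apply: connect_trans xu (connect1 _).
by rewrite /= uv inE nU mem_edges.
Qed.

Lemma cross_setC (V : finType) (G : sgraph V) (A : {set V}) :
  #|cross G (~: A)| = #|cross G A|.
Proof.
have sw : injective (fun p : V * V => (p.2, p.1)) by move=> [? ?] [? ?] [-> ->].
rewrite -(card_imset _ sw); apply: eq_card => -[x y].
apply/imsetP/idP => [[[u v]]|].
  by rewrite !inE /= => /and3P[uA /negPn vA uv] [-> ->]; rewrite uA vA adj_sym.
rewrite inE /= => /and3P[xA yA xy]; exists (y, x) => //.
by rewrite !inE /= xA yA adj_sym.
Qed.

(** Degrees are summed over A: a vertex has at most |A| - 1 neighbours inside A, and its others
    contribute cross edges. *)
Lemma small_cut_side (V : finType) (G : sgraph V) (A : {set V}) (d : nat) :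
  (forall x, d <= degree G x) -> 0 < #|A| -> #|cross G A| < d -> d < #|A|.
Proof.
move=> dmin A0 rd.
have cE : #|cross G A| = \sum_(x in A) #|[set y in ~: A | G x y]|.
  rewrite -sum1_card; under [RHS]eq_bigr do rewrite -sum1_card.
  rewrite pair_big_dep /=; apply: eq_bigl => -[x y].
  by rewrite !inE.
have : \sum_(x in A) d <= \sum_(x in A) (#|A|.-1 + #|[set y in ~: A | G x y]|).
  apply: leq_sum => x xA; apply: leq_trans (dmin x) _.
  rewrite /degree -(cardsID A) leq_add //.
    rewrite (cardsD1 x A) xA /=; apply: subset_leq_card; apply/subsetP=> y.
    rewrite !inE => /andP[xy ->]; rewrite andbT.
    by apply: contraTneq xy => ->; rewrite adj_irr.
  by apply: subset_leq_card; apply/subsetP=> y; rewrite !inE.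
rewrite big_split /= -cE !sum_nat_const.
case: #|A| A0 => // k _ /=; case: (ltnP d k.+1) => // kd.
(* A side with k+1 <= d vertices would have at least (k+1)(d-k) >= d cross edges. *)
have [j dj] : exists j, d = k.+1 + j by exists (d - k.+1); clear -kd; lia.
by rewrite {}dj in rd *; move: #|cross G A| rd => c rd; clear -rd; nia.
Qed.

Fact join_sides_sym (V : finType) (G : sgraph V) (A : {set V}) :
  symmetric (fun x y => if (x \in A) == (y \in A) then x != y else G x y).
Proof. by move=> x y; rewrite eq_sym [x == y]eq_sym adj_sym. Qed.

Fact join_sides_irr (V : finType) (G : sgraph V) (A : {set V}) :
  irreflexive (fun x y => if (x \in A) == (y \in A) then x != y else G x y).
Proof. by move=> x; rewrite !eqxx. Qed.

Definition join_sides (V : finType) (G : sgraph V) (A : {set V}) : sgraph V :=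
  SGraph (join_sides_sym G A) (join_sides_irr G A).

Lemma sub_join_sides (V : finType) (G : sgraph V) (A : {set V}) :
  subrel G (join_sides G A).
Proof.
move=> x y xy /=; case: ifP => // _.
by apply: contraTneq xy => ->; rewrite adj_irr.
Qed.

Lemma cross_join_sides (V : finType) (G : sgraph V) (A : {set V}) :
  cross (join_sides G A) A = cross G A.
Proof. by apply/setP=> -[x y]; rewrite !inE /=; case: (x \in A); case: (y \in A). Qed.

(** * Recognising the extremal graph *)

(** Each side is listed with the ends of the cross edges in front, in a common order, so that the
    i-th cross edge joins the i-th vertices of the two lists. *)
Lemma isomorphic_Mgraph (V : finType) (G : sgraph V) (A : {set V}) :
  0 < #|A| -> 0 < #|~: A| ->
  (forall x y, (x \in A) = (y \in A) -> G x y = (x != y)) ->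
  disjoint_pairs (cross G A) ->
  isomorphic G (Mgraph #|cross G A| #|A| #|~: A|).
Proof.
move=> A0 B0 GA /forall_inP disj.
set X := cross G A in disj *; set r := #|X|.
have [x0 x0A] := card_gt0P A0; pose e0 := (x0, x0).
pose es := enum X; have szes : size es = r by rewrite /r cardE.
have esX p : (p \in es) = (p \in X) by rewrite mem_enum.
pose xs := [seq p.1 | p <- es]; pose ys := [seq p.2 | p <- es].
have Xin p : p \in X -> [/\ p.1 \in A, p.2 \in ~: A & G p.1 p.2].
  by rewrite !inE => /and3P.
have inj12 p q : p \in es -> q \in es -> (p.1 = q.1 \/ p.2 = q.2) -> p = q.
  rewrite !esX => pX qX E; apply/eqP/negPn/negP => npq.
  have /forall_inP/(_ _ qX)/implyP/(_ npq)/andP[/eqP n1 /eqP n2] := disj _ pX.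
  by case: E.
have uxs : uniq xs.
  by rewrite map_inj_in_uniq ?enum_uniq // => p q pX qX E; apply: inj12; auto.
have uys : uniq ys.
  by rewrite map_inj_in_uniq ?enum_uniq // => p q pX qX E; apply: inj12; auto.
pose ext (s : seq V) (S : {set V}) := s ++ [seq x <- enum S | x \notin s].
have extP s (S : {set V}) : uniq s -> {subset s <= S} ->
    [/\ uniq (ext s S), ext s S =i S & size (ext s S) = #|S|].
  move=> us sS; have ue : uniq (ext s S).
    rewrite cat_uniq us filter_uniq ?enum_uniq // andbT /=.
    by apply/hasPn=> x; rewrite mem_filter => /andP[].
  have eS : ext s S =i S.
    move=> x; rewrite mem_cat mem_filter mem_enum.
    by have := sS x; case: (x \in s) => //= ->.
  by split=> //; rewrite -(card_uniqP ue); apply: eq_card.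
have [uLA memLA szLA] : [/\ uniq (ext xs A), ext xs A =i A & size (ext xs A) = #|A|].
  by apply: extP => // x /mapP[p]; rewrite esX => /Xin[pA _ _] ->.
have [uLB memLB szLB] : [/\ uniq (ext ys (~: A)), ext ys (~: A) =i ~: A
                         & size (ext ys (~: A)) = #|~: A|].
  by apply: extP => // x /mapP[p]; rewrite esX => /Xin[_ pB _] ->.
set LA := ext xs A in uLA memLA szLA; set LB := ext ys (~: A) in uLB memLB szLB.
(* The default of [insubd] is reached only off the side, where the final map does not use it. *)
pose fA v : 'I_#|A| := insubd (Ordinal A0) (index v LA).
pose fB v : 'I_#|~: A| := insubd (Ordinal B0) (index v LB).
have fAE v : v \in A -> fA v = index v LA :> nat.
  move=> vA; have lt : index v LA < #|A| by rewrite -szLA index_mem memLA.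
  by rewrite val_insubd lt.
have fBE v : v \in ~: A -> fB v = index v LB :> nat.
  move=> vB; have lt : index v LB < #|~: A| by rewrite -szLB index_mem memLB.
  by rewrite val_insubd lt.
have fAI u v : u \in A -> v \in A -> (fA u == fA v) = (u == v).
  move=> uA vA; apply/eqP/eqP => [E|-> //].
  rewrite -(nth_index x0 (_ : u \in LA)) ?memLA // -fAE // E fAE //.
  by rewrite nth_index ?memLA.
have fBI u v : u \in ~: A -> v \in ~: A -> (fB u == fB v) = (u == v).
  move=> uB vB; apply/eqP/eqP => [E|-> //].
  rewrite -(nth_index x0 (_ : u \in LB)) ?memLB // -fBE // E fBE //.
  by rewrite nth_index ?memLB.
have nthA k : k < r -> nth x0 LA k = (nth e0 es k).1.
  by move=> kr; rewrite nth_cat size_map szes kr (nth_map e0) ?szes.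
have nthB k : k < r -> nth x0 LB k = (nth e0 es k).2.
  by move=> kr; rewrite nth_cat size_map szes kr (nth_map e0) ?szes.
have rA : r <= #|A| by rewrite -szLA size_cat size_map szes leq_addr.
have rB : r <= #|~: A| by rewrite -szLB size_cat size_map szes leq_addr.
have crossE u w : u \in A -> w \in ~: A -> ((fA u == fB w :> nat) && (fA u < r)) = G u w.
  move=> uA wB; rewrite fAE // fBE //; apply/idP/idP => [/andP[/eqP E kr]|uw].
    have uE : u = (nth e0 es (index u LA)).1 by rewrite -nthA ?nth_index ?memLA.
    have wE : w = (nth e0 es (index u LA)).2.
      by rewrite -nthB // E nth_index ?memLB.
    have /Xin[_ _] : nth e0 es (index u LA) \in X by rewrite -esX mem_nth ?szes.
    by rewrite -uE -wE.
  have uwX : (u, w) \in es by rewrite esX !inE /= uA uw -in_setC wB.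
  have kr : index (u, w) es < r by rewrite -szes index_mem.
  have uE : u = nth x0 LA (index (u, w) es) by rewrite nthA // nth_index.
  have wE : w = nth x0 LB (index (u, w) es) by rewrite nthB // nth_index.
  have -> : index u LA = index (u, w) es.
    by rewrite {1}uE index_uniq // szLA (leq_trans kr).
  have -> : index w LB = index (u, w) es.
    by rewrite {1}wE index_uniq // szLB (leq_trans kr).
  by rewrite eqxx.
exists (fun v => if v \in A then inl (fA v) else inr (fB v)).
  apply: inj_card_bij; last by rewrite card_sum !card_ord cardsC.
  move=> u v; case: ifP => uA; case: ifP => vA // -[] /eqP.
    by rewrite fAI // => /eqP.
  by rewrite fBI ?inE ?uA ?vA // => /eqP.
move=> u v; case: ifP => uA; case: ifP => vA /=.
- by rewrite fAI // GA ?uA ?vA.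
- by rewrite crossE // inE vA.
- by rewrite crossE ?inE ?uA // adj_sym.
- by rewrite fBI ?inE ?uA ?vA // GA ?uA ?vA.
Qed.

(** A is the preimage of the first clique, and its cross edges are the images under [g] of the r
    added edges. *)
Lemma Mgraph_isomorphicP (V : finType) (G : sgraph V) (r a b : nat) :
  r <= a -> r <= b -> isomorphic G (Mgraph r a b) -> exists A : {set V},
  [/\ #|A| = a, #|~: A| = b, #|cross G A| = r, disjoint_pairs (cross G A)
    & forall x y, (x \in A) = (y \in A) -> G x y = (x != y)].
Proof.
move=> ra rb [f [g fK gK] fG].
have fI := can_inj fK.
pose isl (s : 'I_a + 'I_b) := if s is inl _ then true else false.
pose A := [set v | isl (f v)]; exists A.
have cA : #|A| = a.
  rewrite -[RHS]card_ord -(card_imset _ (inj_comp (can_inj gK) (@inl_inj 'I_a 'I_b))).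
  apply: eq_card => v; rewrite inE; apply/idP/imsetP => [|[i _ ->]]; last by rewrite /= gK.
  by case E: (f v) => [i|] // _; exists i; rewrite //= -E fK.
have cV : #|V| = a + b.
  by rewrite (bij_eq_card (Bijective fK gK)) card_sum !card_ord.
have cB : #|~: A| = b by apply: (@addnI a); rewrite -{1}cA cardsC.
have crossP p : p \in cross G A -> exists (i : 'I_a) (j : 'I_b),
    [/\ f p.1 = inl i, f p.2 = inr j, i = j :> nat & i < r].
  rewrite !inE -fG; case: (f p.1) => // i; case: (f p.2) => // j /=.
  by case/andP=> /eqP; exists i, j.
split=> //.
- pose h (k : 'I_r) := (g (inl (widen_ord ra k)), g (inr (widen_ord rb k))).
  have hI : injective h by move=> k l [/(can_inj gK)[E] _]; apply: val_inj.
  rewrite -[RHS]card_ord -(card_imset _ hI); apply: eq_card => p.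
  apply/idP/imsetP => [/crossP[i [j [E1 E2 ij ir]]]|[k _ ->]]; last first.
    by rewrite !inE /= !gK /= -fG !gK /= eqxx ltn_ord.
  exists (Ordinal ir) => //; rewrite [p]surjective_pairing /h -(fK p.1) -(fK p.2) E1 E2.
  by congr (g (inl _), g (inr _)); apply: val_inj => //=.
- apply/forall_inP=> p /crossP[i [j [E1 E2 ij _]]]; apply/forall_inP=> q.
  case/crossP=> i' [j' [F1 F2 ij' _]]; apply/implyP; rewrite -negb_or; apply: contra.
  have inlE : (p.1 == q.1) = (i == i').
    by rewrite -(inj_eq fI) E1 F1.
  have inrE : (p.2 == q.2) = (j == j').
    by rewrite -(inj_eq fI) E2 F2.
  have ijE : (i == i') = (j == j') by rewrite -!val_eqE /= ij ij'.
  rewrite inlE inrE ijE orbb => jj'; apply/eqP; rewrite [p]surjective_pairing.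
  by rewrite [q]surjective_pairing; congr (_, _); apply/eqP; rewrite ?inlE ?ijE ?inrE.
- move=> x y; rewrite !inE -fG -(inj_eq fI).
  by case: (f x) => i; case: (f y) => j.
Qed.

(** * The chain of inequalities and its equality cases *)

Lemma degree_min (V : finType) (G : sgraph V) (x : V) : min_degree G <= degree G x.
Proof.
have V0 : 0 < #|V| by apply/card_gt0P; exists x.
by have [_] := (min_degreeP G (min_degree G) V0).1 erefl.
Qed.

Theorem theorem3p4 (r delta n : nat) (V : finType) (G : sgraph V)
    (r_gt0 : 0 < r) (delta_gt0 : 0 < delta) (n_gt0 : 0 < n)
    (r_lt_delta : r < delta) (n_ge : 2 * delta + 2 <= n)
    (order_G : #|V| = n) (conn_G : connected G)
    (ec_G : edge_connectivity G = r) (md_G : min_degree G = delta) :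
  let bound :=
    r * (delta + 1) ^ (delta - r) * (n - delta - 1) ^ (n - delta - r - 2)
      * ((delta + 1) * (n - delta - 1) + n) ^ (r - 1) in
  tau G <= bound /\
  (tau G = bound <-> isomorphic G (Mgraph r (n - delta - 1) (delta + 1))).
Proof.
move=> bound.
have -> : bound = tau_bound r (n - delta - 1) (delta + 1).
  by rewrite /bound /tau_bound; congr (_ * _ ^ _ * _ ^ _ * (_ + _) ^ _); lia.
have V1 : 1 < #|V| by lia.
have dmin x : delta <= degree G x by rewrite -md_G degree_min.
have [A [A0 B0 BA cA]] : exists A : {set V},
    [/\ 0 < #|A|, 0 < #|~: A|, #|~: A| <= #|A| & #|cross G A| = r].
  have [A [A0 B0 cA]] := edge_connectivity_cut G V1; rewrite ec_G in cA.
  have [BA|/ltnW AB] := leqP #|~: A| #|A|; first by exists A.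
  by exists (~: A); rewrite setCK cross_setC.
have dA : delta < #|A| by apply: small_cut_side dmin A0 _; rewrite cA.
have dB : delta < #|~: A|.
  by apply: small_cut_side dmin B0 _; rewrite cross_setC cA.
have nE : #|A| + #|~: A| = n by rewrite cardsC.
pose H := join_sides G A.
have HA x y : (x \in A) = (y \in A) -> H x y = (x != y).
  by move=> xy; rewrite /= xy eqxx.
have cH : #|cross H A| = r by rewrite cross_join_sides.
have leH : tau H <= tau_bound r #|A| #|~: A| ?= iff disjoint_pairs (cross G A).
  have := @tau_two_cliques V H A; rewrite /= cH cross_join_sides.
  by apply=> //; lia.
have leM : tau_bound r #|A| #|~: A| <= tau_bound r (n - delta - 1) (delta + 1)
    ?= iff (#|~: A| == delta + 1).
  have := @tau_bound_max r (delta + 1) #|A| #|~: A|; rewrite nE subnDA.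
  by apply; lia.
have leHM := leqif_trans leH leM.
have [x xA] := card_gt0P A0.
have leG : tau G <= tau H.
  by rewrite !(tau_rooted _ x) subset_leq_card // rooted_sub //; apply: sub_join_sides.
split; first exact: leq_trans leG leHM.
split=> [E|isoG].
  (* Equality throughout forces [tau G = tau H]; strict monotonicity of tau then leaves no edge of
     [H] outside [G]. *)
  have tH : tau G = tau H by apply/eqP; rewrite eqn_leq leG E leHM.
  have /esym/andP[disj /eqP cB] : true = disjoint_pairs (cross G A) && (#|~: A| == delta + 1).
    by have [_ <-] := leHM; rewrite -tH E eqxx.
  have GH : H =2 G.
    move=> u v; apply/idP/idP => [Huv|]; last exact: sub_join_sides.
    apply: contraT => nG.
    by have := tau_lt (@sub_join_sides _ G A) conn_G Huv nG; rewrite -/H tH ltnn.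
  rewrite -cB -cA (_ : n - delta - 1 = #|A|); last by lia.
  by apply: isomorphic_Mgraph => // u v uv; rewrite -GH HA.
(* The partition transported from the extremal graph meets the equality case for two cliques
   directly, whatever cut A was chosen. *)
have [B [aB bB cB dB' GB]] : exists B : {set V},
    [/\ #|B| = n - delta - 1, #|~: B| = delta + 1, #|cross G B| = r,
        disjoint_pairs (cross G B)
      & forall x y, (x \in B) = (y \in B) -> G x y = (x != y)].
  by apply: Mgraph_isomorphicP isoG; lia.
have := @tau_two_cliques V G B; rewrite /= cB aB bB dB'.
by case=> //; try lia; move=> _ /eqP.
Qed.
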